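(* Let $r>0$ be real and $q=e^{-\pi\sqrt r}$. Then $$\sum_{n=-\infty}^{\infty}(-1)^n q^{2n^2+3n/2}=q^{-11/96}\,\eta(q^4)\,\sqrt[48]{\frac{4(1-k_r)^4\left(2+k_r-2\sqrt{1+k_r}\right)^{12}}{k_r^{13}(1+k_r)^2}} .$$
   Context: $\eta(q):=\prod_{n=1}^\infty(1-q^n)$ for $|q|<1$ (no factor $q^{1/24}$). $K(x)=\frac{\pi}{2}\,{}_2F_1(\frac12,\frac12;1;x^2)$, $|x|<1$, is the complete elliptic integral of the first kind. For $r>0$, the elliptic singular modulus $k_r\in(0,1)$ is the solution of $K(\sqrt{1-k_r^2})/K(k_r)=\sqrt r$; equivalently $k_r=\theta_2(q)^2/\theta_3(q)^2$ with $q=e^{-\pi\sqrt r}$, $\theta_2(q)=\sum_{n\in\mathbb Z}q^{(n+1/2)^2}$, $\theta_3(q)=\sum_{n\in\mathbb Z}q^{n^2}$. Roots and fractional powers are positive real ones. *)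

(* Defs.v *)
From Stdlib Require Import Reals ZArith ClassicalEpsilon.
From Coquelicot Require Import Coquelicot.
Open Scope R_scope.

Fixpoint pochhammer (a : R) (n : nat) : R :=
  match n with
  | O => 1
  | S m => pochhammer a m * (a + INR m)
  end.

Definition hyp2F1 (a b c x : R) : R :=
  PSeries
    (fun n => pochhammer a n * pochhammer b n / (pochhammer c n * INR (fact n)))
    x.

(* Complete elliptic integral of the first kind as a function of the modulus
   [x] (not of the parameter [x ^ 2]), for [Rabs x < 1]. *)
Definition elliptic_K (x : R) : R := PI / 2 * hyp2F1 (1 / 2) (1 / 2) 1 (x ^ 2).

Definition is_singular_modulus (r k : R) : Prop :=
  0 < k < 1 /\ elliptic_K (sqrt (1 - k ^ 2)) / elliptic_K k = sqrt r.

(* For [0 < r] there is exactly one such [k]; [epsilon] only names it. *)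
Definition singular_modulus (r : R) : R :=
  epsilon (inhabits 0) (is_singular_modulus r).

(* Euler's product, the factors being [1 - q ^ n] for [n >= 1]; there is no
   factor [q ^ (1 / 24)], unlike in the Dedekind eta function.
   [prod_f_R0 f N] has the [N + 1] factors [f 0], ..., [f N]. *)
Definition eta (q : R) : R :=
  real (Lim_seq (fun N => prod_f_R0 (fun n => 1 - q ^ S n) N)).

(* The series of [a n] over all integers [n] converges to [l]: its halves
   [n >= 0] and [n < 0] converge separately, with sums adding up to [l]. *)
Definition is_bilateral_series (a : Z -> R) (l : R) : Prop :=
  exists l1 l2 : R,
    is_series (fun n : nat => a (Z.of_nat n)) l1 /\
    is_series (fun n : nat => a (- Z.of_nat (S n))%Z) l2 /\
    l = l1 + l2.

(* Main.v *)
Require Import Defs.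
From Stdlib Require Import Reals ZArith Lra Lia ClassicalEpsilon.
From Coquelicot Require Import Coquelicot.
Open Scope R_scope.

(** By the Jacobi triple product the series equals [eta (q ^ 4)] times the product [A] of the
[1 - p ^ n] over [n = 1, 7 (mod 8)], where [p = sqrt q]. With [B] the same product over
[n = 3, 5 (mod 8)], [A * B = eta p / eta (p ^ 2)], and [v = sqrt p * A / B] is the
Ramanujan-Goellnitz-Gordon continued fraction. The triple product at an imaginary argument,
split into real and imaginary parts, evaluates [B ^ 2 + p * A ^ 2], hence [v + 1 / v], and
everything becomes a function of [k = theta_2 (q) ^ 2 / theta_3 (q) ^ 2].

That this [k] is the singular modulus is shown without the modular transformation of theta
functions. The period ratio [K (k') / K (k)] doubles under the Landen transformation, and so does
[- ln q] under [q -> q ^ 2], which acts on [k] by a Landen step. Iterating, the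
ratio is determined by the logarithmic asymptotics of [K] at [1], which come from Wallis' bounds
on the hypergeometric coefficients. *)

(** * The hypergeometric series of the complete elliptic integral *)

(** In base [p] the exponent [2 n^2 + 3 n / 2] of [q] becomes the integer [4 n^2 + 3 n], which is
    why everything is developed in [p]. The singular modulus is a choice by [epsilon] from an
    equation between transcendental functions, so it is accessible only through an explicit
    solution: the theta quotient, singled out by strict monotonicity of the period ratio. Complex
    numbers are avoided: a partial triple product is a Laurent polynomial in [z] whose even and odd
    parts are real functions of [w = z ^ 2], and the product of its values at [z] and [- z] is a
    norm form in these parts that stays meaningful for [w < 0]. The 48th root comes from
    [A ^ 48 = (A * B) ^ 24 * (A / B) ^ 24]: the 24th power of [A * B] is [p] times a rational
    function of [k], and [p * (A / B) ^ 2] is a function of [k]. This leaves [p ^ (-11)], whose 48th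
    root is the prefactor [q ^ (-11 / 96)]. *)

Definition wallis (n : nat) : R := RInt (fun x => sin x ^ n) 0 (PI / 2).

Lemma continuous_sin_pow (n : nat) (x : R) : continuous (fun y => sin y ^ n) x.
Proof. apply (ex_derive_continuous (fun y => sin y ^ n)). auto_derive. trivial. Qed.

Lemma ex_RInt_sin_pow (n : nat) (a b : R) : ex_RInt (fun x => sin x ^ n) a b.
Proof. apply (ex_RInt_continuous (fun x => sin x ^ n)). intros. apply continuous_sin_pow. Qed.

(** The difference of the two sides is the integral of the derivative of
    [- cos x * sin x ^ (n + 1)], which vanishes at both ends of the interval. *)
Lemma wallis_rec (n : nat) : INR (n + 2) * wallis (n + 2) = INR (n + 1) * wallis n.
Proof.
assert (H : is_RInt (fun x => INR (n + 2) * sin x ^ (n + 2) - INR (n + 1) * sin x ^ n)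
   0 (PI / 2) (minus (- cos (PI / 2) * sin (PI / 2) ^ (n + 1)) (- cos 0 * sin 0 ^ (n + 1)))).
{ apply (is_RInt_derive (fun x => - cos x * sin x ^ (n + 1))).
  - intros x _. auto_derive. trivial.
    replace (Init.Nat.pred (n + 1)) with n by lia.
    rewrite !pow_add, !plus_INR. simpl.
    generalize (sin2_cos2 x). unfold Rsqr. intros E.
    replace (sin x * (sin x * 1)) with (sin x * sin x) by ring.
    replace (sin x * sin x) with (1 - cos x * cos x) by lra.
    replace (sin x ^ n * (sin x * 1)) with (sin x ^ n * sin x) by ring.
    transitivity (sin x * sin x * sin x ^ n - cos x * cos x * (INR n + 1) * sin x ^ n).
    ring. replace (sin x * sin x) with (1 - cos x * cos x) by lra. ring.
  - intros x _.
    apply (ex_derive_continuous (fun x => INR (n + 2) * sin x ^ (n + 2) - INR (n + 1) * sin x ^ n)).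
    auto_derive. trivial. }
rewrite cos_PI2, sin_0, pow_ne_zero in H by lia.
assert (H2 : is_RInt (fun x => INR (n + 2) * sin x ^ (n + 2) - INR (n + 1) * sin x ^ n)
   0 (PI / 2) (INR (n + 2) * wallis (n + 2) - INR (n + 1) * wallis n)).
{ apply (is_RInt_minus (V := R_NormedModule)); apply (is_RInt_scal (V := R_NormedModule));
  apply (RInt_correct (V := R_CompleteNormedModule)), ex_RInt_sin_pow. }
apply (is_RInt_unique (V := R_CompleteNormedModule)) in H.
apply (is_RInt_unique (V := R_CompleteNormedModule)) in H2. rewrite H in H2.
unfold minus, plus, opp in H2; simpl in H2. lra.
Qed.

Lemma wallis_0 : wallis 0 = PI / 2.
Proof. unfold wallis. simpl. rewrite RInt_const. unfold scal; simpl; unfold mult; simpl. lra. Qed.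

Lemma wallis_1 : wallis 1 = 1.
Proof.
unfold wallis. rewrite (is_RInt_unique _ _ _ (minus (- cos (PI / 2)) (- cos 0))).
- rewrite cos_PI2, cos_0. unfold minus, plus, opp; simpl. lra.
- apply (is_RInt_derive (fun x => - cos x)).
  + intros x _. auto_derive. trivial. ring.
  + intros x _. apply continuous_sin_pow.
Qed.

Lemma wallis_decr (n : nat) : wallis (S n) <= wallis n.
Proof.
generalize PI_RGT_0; intros HP.
apply RInt_le; try apply ex_RInt_sin_pow. lra.
intros x Hx. simpl.
assert (0 <= sin x) by (apply sin_ge_0; lra).
generalize (SIN_bound x) (pow_le _ n H); intros. nra.
Qed.

(** By [wallis_rec] the left side does not depend on [n]. With monotonicity this confines
    [wallis n ^ 2] to values of order [1 / n], and it is the source of the constant [1 / PI] in the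
    coefficient bounds. *)
Lemma wallis_prod (n : nat) : INR (n + 1) * wallis (n + 1) * wallis n = PI / 2.
Proof.
induction n as [|n IH].
- simpl. rewrite wallis_0, wallis_1. ring.
- replace (S n + 1)%nat with (n + 2)%nat by lia. rewrite wallis_rec.
  rewrite <- IH. replace (S n) with (n + 1)%nat by lia. ring.
Qed.

(** The sign of the integrand gives the weak inequality; the product formula excludes zero. *)
Lemma wallis_pos (n : nat) : 0 < wallis n.
Proof.
assert (H : 0 <= wallis n).
{ generalize PI_RGT_0; intros HP. apply RInt_ge_0. lra. apply ex_RInt_sin_pow.
  intros x Hx. apply pow_le, sin_ge_0; lra. }
generalize (wallis_prod n) PI_RGT_0. intros. destruct H as [H|H]. trivial.
rewrite <- H in H0. lra.
Qed.

(** The square of the central binomial coefficient divided by [4 ^ n]. *)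
Definition ell_coef (n : nat) : R := (pochhammer (1 / 2) n / INR (fact n)) ^ 2.

Lemma pochhammer_1 (n : nat) : pochhammer 1 n = INR (fact n).
Proof.
induction n as [|n IH]. reflexivity.
change (fact (S n)) with (S n * fact n)%nat. rewrite mult_INR, S_INR, <- IH.
simpl pochhammer. ring.
Qed.

Lemma hyp2F1_half (x : R) : hyp2F1 (1 / 2) (1 / 2) 1 x = PSeries ell_coef x.
Proof.
apply PSeries_ext. intros n. rewrite pochhammer_1. unfold ell_coef.
field. apply INR_fact_neq_0.
Qed.

Lemma wallis_even (n : nat) : wallis (2 * n) = PI / 2 * (pochhammer (1 / 2) n / INR (fact n)).
Proof.
induction n as [|n IH].
- simpl. rewrite wallis_0. field.
- replace (2 * S n)%nat with (2 * n + 2)%nat by lia.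
  generalize (wallis_rec (2 * n)). rewrite IH, !plus_INR, mult_INR.
  change (fact (S n)) with (S n * fact n)%nat. rewrite mult_INR, S_INR. simpl pochhammer.
  simpl (INR _).
  generalize (pos_INR n) (INR_fact_neq_0 n); intros.
  apply Rmult_eq_reg_l with ((1 + 1) * INR n + (1 + 1)); [|lra].
  rewrite H1. change (match n with 0%nat => 1 | S _ => INR n + 1 end) with (INR (S n)).
  rewrite S_INR. field. split; lra.
Qed.

Lemma ell_coef_wallis (n : nat) : ell_coef n = (2 / PI * wallis (2 * n)) ^ 2.
Proof. rewrite wallis_even. unfold ell_coef. field. generalize PI_RGT_0 (INR_fact_neq_0 n).
split; lra. Qed.

Lemma ell_coef_pos (n : nat) : 0 < ell_coef n.
Proof.
rewrite ell_coef_wallis. generalize PI_RGT_0; intros. apply pow_lt, Rmult_lt_0_compat.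
apply Rdiv_lt_0_compat; lra. apply wallis_pos.
Qed.

Lemma ell_coef_0 : ell_coef 0 = 1.
Proof. unfold ell_coef. simpl. field. Qed.

Lemma ell_coef_S (n : nat) : (INR n + 1) ^ 2 * ell_coef (S n) = (INR n + 1 / 2) ^ 2 * ell_coef n.
Proof.
unfold ell_coef. change (fact (S n)) with (S n * fact n)%nat. rewrite mult_INR, S_INR.
simpl pochhammer. generalize (pos_INR n) (INR_fact_neq_0 n); intros. field. split; lra.
Qed.

(** Wallis' product at [2 n - 1] combined with [wallis (2 n) <= wallis (2 n - 1)]. The lower bound
    has the same constant, so the logarithmic singularity of the series at 1 is found with its exact
    coefficient. *)
Lemma ell_coef_upper (n : nat) : INR n * ell_coef n <= 1 / PI.
Proof.
generalize PI_RGT_0; intros HP.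
destruct n as [|n]. { simpl. rewrite Rmult_0_l. apply Rlt_le, Rdiv_lt_0_compat; lra. }
rewrite ell_coef_wallis.
set (m := (2 * n + 1)%nat). replace (2 * S n)%nat with (m + 1)%nat by lia.
generalize (wallis_prod m) (wallis_decr m) (wallis_pos (m + 1)).
replace (S m) with (m + 1)%nat by lia. intros H1 H2 H3.
assert (E : INR (m + 1) = 2 * INR (S n)).
{ unfold m. rewrite (S_INR n), !plus_INR, mult_INR. simpl. ring. }
rewrite E in H1. assert (0 < INR (S n)) by (apply lt_0_INR; lia).
replace (1 / PI) with (INR (S n) * (4 / PI ^ 2 * (wallis (m + 1) * wallis m))).
2: { replace (wallis (m + 1) * wallis m) with (PI / 4 / INR (S n)). field. lra.
     field_simplify_eq. lra. lra. }
replace ((2 / PI * wallis (m + 1)) ^ 2) with (4 / PI ^ 2 * (wallis (m + 1) * wallis (m + 1))) by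
  (field; lra).
apply Rmult_le_compat_l. lra. apply Rmult_le_compat_l.
apply Rlt_le, Rdiv_lt_0_compat. lra. apply pow_lt; lra. apply Rmult_le_compat_l; lra.
Qed.

Lemma ell_coef_lower (n : nat) : 1 / PI <= (INR n + 1) * ell_coef n.
Proof.
generalize PI_RGT_0; intros HP.
rewrite ell_coef_wallis. set (m := (2 * n)%nat).
generalize (wallis_prod m) (wallis_decr m) (wallis_pos m).
replace (S m) with (m + 1)%nat by lia. intros H1 H2 H3.
assert (E : INR (m + 1) = 2 * INR n + 1).
{ unfold m. rewrite !plus_INR, mult_INR. simpl. ring. }
rewrite E in H1. generalize (pos_INR n); intros Hn.
replace ((2 / PI * wallis m) ^ 2) with (4 / PI ^ 2 * (wallis m * wallis m)) by (field; lra).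
assert (K : PI / 2 / (2 * INR n + 1) <= wallis m * wallis m).
{ apply Rle_div_l. lra. rewrite <- H1.
  assert (wallis (m + 1) * wallis m <= wallis m * wallis m) by nra. nra. }
apply Rle_trans with ((INR n + 1) * (4 / PI ^ 2 * (PI / 2 / (2 * INR n + 1)))).
- replace ((INR n + 1) * (4 / PI ^ 2 * (PI / 2 / (2 * INR n + 1)))) with (1 / PI * ((2 * INR n + 2)
  / (2 * INR n + 1))) by (field; split; lra).
  rewrite <- (Rmult_1_r (1 / PI)) at 1. apply Rmult_le_compat_l.
  apply Rlt_le, Rdiv_lt_0_compat; lra. apply Rle_div_r; lra.
- apply Rmult_le_compat_l. lra. apply Rmult_le_compat_l; trivial.
  apply Rlt_le, Rdiv_lt_0_compat. lra. apply pow_lt; lra.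
Qed.

Lemma CV_radius_ell_coef : CV_radius ell_coef = 1.
Proof.
rewrite (CV_radius_finite_DAlembert ell_coef 1). { f_equal. lra. }
- intros n. generalize (ell_coef_pos n). lra.
- lra.
- apply is_lim_seq_ext with (fun n => (1 - 1 / 2 * / (INR n + 1)) ^ 2).
  + intros n. generalize (ell_coef_pos n) (ell_coef_S n) (pos_INR n) (ell_coef_pos (S n)); intros.
    rewrite Rabs_pos_eq by (apply Rlt_le, Rdiv_lt_0_compat; lra).
    apply Rmult_eq_reg_r with ((INR n + 1) ^ 2 * ell_coef n).
    transitivity ((INR n + 1 / 2) ^ 2 * ell_coef n). field; lra.
    rewrite <- H0. field. lra. apply Rgt_not_eq, Rmult_lt_0_compat; trivial. apply pow_lt; lra.
  + replace (Finite 1) with (Finite ((1 - 1 / 2 * 0) ^ 2)) by (f_equal; ring).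
    apply (is_lim_seq_continuous (fun y => (1 - 1 / 2 * y) ^ 2)).
    * apply derivable_continuous_pt, ex_derive_Reals_0. auto_derive. trivial.
    * apply is_lim_seq_ext with (fun n => / INR (S n)). intros. rewrite S_INR. trivial.
      apply (is_lim_seq_incr_1 (fun n => / INR n)).
      replace (Finite 0) with (Rbar_inv p_infty) by reflexivity.
      apply is_lim_seq_inv. apply is_lim_seq_INR. discriminate.
Qed.

(** * The normalised elliptic integral: self-adjoint equation and logarithmic bounds at 1 *)

Lemma ell_disk (a : nat -> R) (x : R) :
  CV_radius a = 1 -> Rabs x < 1 -> Rbar_lt (Rabs x) (CV_radius a).
Proof. intros -> H. exact H. Qed.

(** The function [2 K / PI] in the parameter [x = k ^ 2]. *)
Definition ell (x : R) : R := PSeries ell_coef x.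

(** Coefficients of [x (1 - x)] times the derivative of [ell]. With a power series of its own for
    this flux, the hypergeometric equation says that the flux has derivative [ell / 4], and second
    derivatives of [ell] never occur. *)
Definition ell_flux_coef (n : nat) : R :=
  match n with
  | O => 0
  | S m => INR (S m) * ell_coef (S m) - INR m * ell_coef m
  end.

Definition ell_flux (x : R) : R := PSeries ell_flux_coef x.

(** The hypergeometric equation at the level of coefficients:
    [(n + 1 / 2) ^ 2 - n (n + 1) = 1 / 4]. *)
Lemma ell_flux_coef_S (n : nat) : PS_derive ell_flux_coef n = PS_scal (1 / 4) ell_coef n.
Proof.
unfold PS_derive, PS_scal, ell_flux_coef, scal; simpl; unfold mult; simpl.
change (match n with O => 1 | S _ => INR n + 1 end) with (INR (S n)).
generalize (ell_coef_S n). rewrite S_INR. intros. lra.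
Qed.

Lemma CV_radius_ell_flux : CV_radius ell_flux_coef = 1.
Proof.
rewrite <- CV_radius_derive, (CV_radius_ext _ _ ell_flux_coef_S), CV_radius_scal,
  CV_radius_ell_coef. trivial. lra.
Qed.

Lemma is_derive_ell (x : R) : Rabs x < 1 -> is_derive ell x (PSeries (PS_derive ell_coef) x).
Proof. intros H. apply is_derive_PSeries, ell_disk; trivial. apply CV_radius_ell_coef. Qed.

Lemma is_derive_ell_flux (x : R) : Rabs x < 1 -> is_derive ell_flux x (ell x / 4).
Proof.
intros H. replace (ell x / 4) with (PSeries (PS_derive ell_flux_coef) x).
apply is_derive_PSeries, ell_disk; trivial. apply CV_radius_ell_flux.
rewrite (PSeries_ext _ _ _ ell_flux_coef_S), PSeries_scal. unfold ell. field.
Qed.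

Lemma ell_flux_eq (x : R) : Rabs x < 1 ->
  ell_flux x = x * (1 - x) * PSeries (PS_derive ell_coef) x.
Proof.
intros H. assert (D : ex_pseries (PS_derive ell_coef) x).
{ apply CV_radius_inside. rewrite CV_radius_derive, CV_radius_ell_coef. exact H. }
transitivity (PSeries (PS_incr_1 (PS_minus (PS_derive ell_coef) (PS_incr_1 (PS_derive ell_coef))))
  x).
- apply PSeries_ext. intros [|n]; simpl; trivial.
  unfold PS_minus, PS_opp, PS_plus, PS_derive, PS_incr_1, plus, opp; simpl.
  destruct n as [|n]; simpl. unfold zero; simpl. ring. ring.
- rewrite PSeries_incr_1, PSeries_minus, PSeries_incr_1. ring. trivial. apply ex_pseries_incr_1, D.
Qed.

Lemma ell_0 : ell 0 = 1.
Proof. unfold ell. rewrite PSeries_0. apply ell_coef_0. Qed.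

Lemma ell_flux_0 : ell_flux 0 = 0.
Proof. unfold ell_flux. rewrite PSeries_0. reflexivity. Qed.

Lemma ex_pseries_ell (x : R) : Rabs x < 1 -> ex_pseries ell_coef x.
Proof. intros. apply CV_radius_inside, ell_disk; trivial. apply CV_radius_ell_coef. Qed.

Lemma PSeries_nonneg (a : nat -> R) (x : R) :
  0 <= x -> (forall n, 0 <= a n) -> ex_pseries a x -> 0 <= PSeries a x.
Proof.
intros Hx Ha He. unfold PSeries. apply Rle_trans with (Series (fun n => 0 * x ^ n)).
rewrite Series_scal_l. lra. apply Series_le.
- intros n. generalize (Ha n) (pow_le _ n Hx); intros. split. lra. apply Rmult_le_compat_r; trivial.
- apply (ex_series_ext (fun n => scal (pow_n x n) (a n))).
  intros n. rewrite pow_n_pow. unfold scal; simpl; unfold mult; simpl. ring. exact He.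
Qed.

Lemma Rabs_unit (x : R) : 0 <= x < 1 -> Rabs x < 1.
Proof. intros. rewrite Rabs_pos_eq; lra. Qed.

Lemma monotone_of_derive (f df : R -> R) (b : R) :
  0 <= b -> (forall x, 0 <= x <= b -> is_derive f x (df x)) ->
  (forall x, 0 <= x <= b -> 0 <= df x) -> f 0 <= f b.
Proof.
intros Hb Hf Hd. destruct (MVT_gen f 0 b df) as [c [Hc E]];
  rewrite ?Rmin_left, ?Rmax_right in * by lra.
- intros x Hx. apply Hf. lra.
- intros x Hx. apply derivable_continuous_pt, ex_derive_Reals_0. eexists. apply Hf. lra.
- assert (0 <= df c * (b - 0)) by (apply Rmult_le_pos; [apply Hd; lra | lra]). lra.
Qed.

Lemma PSeries_one (x : R) : Rabs x < 1 -> ex_pseries (fun _ => 1) x /\ PSeries (fun _ => 1) x = /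
  (1 - x).
Proof.
intros H. assert (I : is_pseries (fun _ => 1) x (/ (1 - x))).
{ unfold is_pseries. eapply is_series_ext. 2: apply is_series_geom, H.
  intros n. unfold scal; simpl; unfold mult; simpl. rewrite Rmult_1_r. symmetry. apply pow_n_pow. }
split. eexists; exact I. apply is_pseries_unique, I.
Qed.

(** Both sides equal 1 at 0, and the derivative of their difference is a power series with
    nonnegative coefficients by [ell_coef_upper]. *)
Lemma ell_upper (x : R) : 0 <= x < 1 -> ell x <= 1 - ln (1 - x) / PI.
Proof.
intros Hx. generalize PI_RGT_0; intros HP.
cut (1 - ln (1 - 0) / PI - ell 0 <= 1 - ln (1 - x) / PI - ell x).
{ rewrite ell_0, Rminus_0_r, ln_1. lra. }
apply (monotone_of_derive (fun y => 1 - ln (1 - y) / PI - ell y)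
  (fun y => 1 / PI * PSeries (fun _ => 1) y - PSeries (PS_derive ell_coef) y)).
- lra.
- intros y Hy. apply (is_derive_minus (fun y => 1 - ln (1 - y) / PI)).
  + auto_derive. lra. rewrite (proj2 (PSeries_one y (Rabs_unit y ltac:(lra)))). field. lra.
  + apply is_derive_ell, Rabs_unit. lra.
- intros y Hy. assert (A : Rabs y < 1) by (apply Rabs_unit; lra).
  destruct (PSeries_one y A) as [E _].
  rewrite <- PSeries_scal, <- PSeries_minus.
  apply PSeries_nonneg. lra.
  + intros n. unfold PS_minus, PS_opp, PS_plus, PS_scal, PS_derive, plus, opp, scal; simpl; unfold
      mult; simpl.
    change (match n with O => 1 | S _ => INR n + 1 end) with (INR (S n)).
    generalize (ell_coef_upper (S n)). lra.
  + apply ex_pseries_minus. apply ex_pseries_scal. apply Rmult_comm. trivial.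
    apply CV_radius_inside. rewrite CV_radius_derive, CV_radius_ell_coef. exact A.
  + apply ex_pseries_scal. apply Rmult_comm. trivial.
  + apply CV_radius_inside. rewrite CV_radius_derive, CV_radius_ell_coef. exact A.
Qed.

Lemma ell_increasing (x y : R) : 0 <= x < y -> y < 1 -> ell x < ell y.
Proof.
intros Hx Hy. assert (HI : forall z, 0 <= z < 1 -> ex_series (fun n => ell_coef n * z ^ n)).
{ intros z Hz. apply (ex_series_ext (fun n => scal (pow_n z n) (ell_coef n))).
  intros n. unfold scal; simpl; unfold mult; simpl. rewrite pow_n_pow. ring.
  apply ex_pseries_ell, Rabs_unit, Hz. }
unfold ell, PSeries.
rewrite (Series_incr_1 (fun n => ell_coef n * x ^ n)), (Series_incr_1 (fun n => ell_coef n * y ^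
  n)) by (apply HI; lra).
rewrite (Series_incr_1 (fun n => ell_coef (S n) * x ^ S n)), (Series_incr_1 (fun n => ell_coef (S
  n) * y ^ S n)).
2,3 : apply (ex_series_incr_1 (fun n => ell_coef n * _ ^ n)), HI; lra.
assert (Series (fun k => ell_coef (S (S k)) * x ^ S (S k)) <= Series (fun k => ell_coef (S (S k)) *
  y ^ S (S k))).
{ apply Series_le.
  - intros n. generalize (ell_coef_pos (S (S n))); intros P. split.
    apply Rmult_le_pos. lra. apply pow_le. lra.
    apply Rmult_le_compat_l. lra. apply pow_incr. lra.
  - apply (ex_series_incr_1 (fun n => ell_coef (S n) * y ^ S n)), (ex_series_incr_1 (fun n =>
      ell_coef n * y ^ n)), HI; lra. }
assert (P := ell_coef_pos 1). simpl pow in *.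
assert (ell_coef 1 * x < ell_coef 1 * y) by (apply Rmult_lt_compat_l; lra). lra.
Qed.

Lemma ell_ge_1 (x : R) : 0 <= x < 1 -> 1 <= ell x.
Proof.
intros [[H|<-] H1]. rewrite <- ell_0. apply Rlt_le, ell_increasing; lra. rewrite ell_0. lra.
Qed.

Lemma ell_lower (x : R) : 0 <= x < 1 -> - ln (1 - x) / PI <= ell x.
Proof.
intros Hx. generalize PI_RGT_0; intros HP.
(* The bound on [(n + 1) * ell_coef n] concerns the derivative of [x * ell x] rather than that of
   [ell]; dropping the factor [x < 1] afterwards only increases the right side. *)
assert (0 * ell 0 + ln (1 - 0) / PI <= x * ell x + ln (1 - x) / PI).
2: { rewrite Rminus_0_r, ln_1 in H. generalize (ell_ge_1 x Hx). intros.
     assert (x * ell x <= 1 * ell x) by (apply Rmult_le_compat_r; lra).  lra. }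
apply (monotone_of_derive (fun y => y * ell y + ln (1 - y) / PI)
  (fun y => PSeries (PS_derive (PS_incr_1 ell_coef)) y - 1 / PI * PSeries (fun _ => 1) y)).
- lra.
- intros y Hy. apply (is_derive_ext (fun y => PSeries (PS_incr_1 ell_coef) y + ln (1 - y) / PI)).
  { intros t. rewrite PSeries_incr_1. trivial. }
  unfold Rminus. apply (is_derive_plus (PSeries (PS_incr_1 ell_coef)) (fun y => ln (1 - y) / PI)).
  + apply is_derive_PSeries. rewrite CV_radius_incr_1, CV_radius_ell_coef. apply Rabs_unit; lra.
  + auto_derive. lra. rewrite (proj2 (PSeries_one y (Rabs_unit y ltac:(lra)))). field. lra.
- intros y Hy. assert (A : Rabs y < 1) by (apply Rabs_unit; lra).
  destruct (PSeries_one y A) as [E _].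
  assert (EX : ex_pseries (PS_derive (PS_incr_1 ell_coef)) y).
  { apply CV_radius_inside. rewrite CV_radius_derive, CV_radius_incr_1, CV_radius_ell_coef.
    exact A. }
  rewrite <- PSeries_scal, <- PSeries_minus; trivial.
  apply PSeries_nonneg. lra.
  + intros n. unfold PS_minus, PS_opp, PS_plus, PS_scal, PS_derive, PS_incr_1, plus, opp, scal;
      simpl; unfold mult; simpl.
    change (match n with O => 1 | S _ => INR n + 1 end) with (INR (S n)). rewrite S_INR.
    generalize (ell_coef_lower n). lra.
  + apply ex_pseries_minus; trivial. apply ex_pseries_scal. apply Rmult_comm. trivial.
  + apply ex_pseries_scal. apply Rmult_comm. trivial.
Qed.

(** * The Landen transformation and the period ratio *)

Definition landen (k : R) : R := 4 * k / (1 + k) ^ 2.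

Lemma landen_bounds (k : R) : 0 <= k < 1 -> 0 <= landen k < 1.
Proof.
intros Hk. unfold landen. assert (0 < (1 + k) ^ 2) by (apply pow_lt; lra). split.
- apply Rdiv_le_0_compat; lra.
- apply Rlt_div_l. lra. assert (0 < (1 - k) ^ 2) by (apply pow_lt; lra). lra.
Qed.

(** The flux [k (1 - k ^ 2) y'] of [y = ell (landen k) / (1 + k)], as [landen_flux_l_eq] shows.
    Written through [ell_flux], it can be differentiated with first derivatives of [ell] only. *)
Definition landen_flux_l (k : R) : R :=
  (1 + k) * ell_flux (landen k) - k * (1 - k) / (1 + k) * ell (landen k).

Definition ell' (x : R) : R := PSeries (PS_derive ell_coef) x.

Lemma is_derive_landen (k : R) : 0 <= k < 1 -> is_derive landen k (4 * (1 - k) / (1 + k) ^ 3).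
Proof.
intros Hk. unfold landen. auto_derive. apply Rgt_not_eq, Rmult_lt_0_compat; lra.
field. lra.
Qed.

Lemma is_derive_scale_comp (f u : R -> R) (k df du : R) :
  is_derive f (u k) df -> is_derive u k du -> is_derive (fun k => f (u k)) k (du * df).
Proof. intros. apply (is_derive_comp f u); trivial. Qed.

Lemma is_derive_landen_l (k : R) : 0 <= k < 1 ->
  is_derive (fun k => ell (landen k) / (1 + k)) k
    (ell' (landen k) * (4 * (1 - k) / (1 + k) ^ 3) / (1 + k) - ell (landen k) / (1 + k) ^ 2).
Proof.
intros Hk.
evar_last. apply is_derive_div.
- apply (is_derive_scale_comp ell landen).
  apply is_derive_ell, Rabs_unit, landen_bounds, Hk. apply is_derive_landen, Hk.
- apply (is_derive_plus (fun _ => 1) (fun k => k)). apply is_derive_const. apply is_derive_id.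
- lra.
- unfold plus, zero, one, ell'; simpl. field. lra.
Qed.

Lemma is_derive_landen_flux_l (k : R) : 0 < k < 1 ->
  is_derive landen_flux_l k (k * (ell (landen k) / (1 + k))).
Proof.
intros Hk. unfold landen_flux_l.
assert (B := landen_bounds k ltac:(lra)).
evar_last.
apply (is_derive_minus (fun k => (1 + k) * ell_flux (landen k)) (fun k => k * (1 - k) / (1 + k) *
  ell (landen k))).
- apply (is_derive_mult (fun k => 1 + k) (fun k => ell_flux (landen k))).
  + apply (is_derive_plus (fun _ => 1) (fun k => k)). apply is_derive_const. apply is_derive_id.
  + apply (is_derive_scale_comp ell_flux landen). apply is_derive_ell_flux, Rabs_unit, B.
    apply is_derive_landen; lra.
  + intros; apply Rmult_comm.
- apply (is_derive_mult (fun k => k * (1 - k) / (1 + k)) (fun k => ell (landen k))).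
  + instantiate (1 := (1 - 2 * k - k ^ 2) / (1 + k) ^ 2). auto_derive. lra. field. lra.
  + apply (is_derive_scale_comp ell landen). apply is_derive_ell, Rabs_unit, B.
    apply is_derive_landen; lra.
  + intros; apply Rmult_comm.
- unfold minus, plus, zero, one, mult, opp; simpl. rewrite ell_flux_eq by apply Rabs_unit, B.
  fold (ell' (landen k)). generalize (ell' (landen k)) (ell (landen k)). intros e' e.
  unfold landen. field. lra.
Qed.

Lemma is_derive_landen_r (k : R) : 0 <= k < 1 ->
  is_derive (fun k => ell (k ^ 2)) k (2 * k * ell' (k ^ 2)).
Proof.
intros Hk. apply (is_derive_scale_comp ell (fun k => k ^ 2)).
- apply is_derive_ell, Rabs_unit. nra.
- auto_derive. trivial. ring.
Qed.

Lemma is_derive_landen_flux_r (k : R) : 0 <= k < 1 ->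
  is_derive (fun k => 2 * ell_flux (k ^ 2)) k (k * ell (k ^ 2)).
Proof.
intros Hk. replace (k * ell (k ^ 2)) with (2 * ((2 * k) * (ell (k ^ 2) / 4))) by field.
apply is_derive_scal.
apply (is_derive_scale_comp ell_flux (fun k => k ^ 2)).
- apply is_derive_ell_flux, Rabs_unit. nra.
- auto_derive. trivial. ring.
Qed.

Lemma continuity_pt_of_is_derive (f : R -> R) (x d : R) : is_derive f x d -> continuity_pt f x.
Proof. intros H. apply derivable_continuous_pt, ex_derive_Reals_0. eexists. apply H. Qed.

(** The derivative is required in the open interval only: the weight [k (1 - k ^ 2)] vanishes at 0,
    so the Wronskian says nothing about the derivative of a quotient there. *)
Lemma is_derive_zero_const (f : R -> R) (b : R) :
  0 < b -> (forall x, 0 < x < b -> is_derive f x 0) -> continuity_pt f 0 -> continuity_pt f b ->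
  f b = f 0.
Proof.
intros Hb Hf H0 H1.
destruct (MVT_gen f 0 b (fun _ => 0)) as [c [Hc E]];
  rewrite ?Rmin_left, ?Rmax_right in * by lra; try lra; trivial.
intros x Hx. destruct (Req_dec x 0) as [->|N0]; trivial. destruct (Req_dec x b) as [->|N1]; trivial.
apply (continuity_pt_of_is_derive f x 0), Hf. lra.
Qed.

Lemma landen_flux_l_eq (k : R) : 0 <= k < 1 ->
  landen_flux_l k = k * (1 - k ^ 2) * (ell' (landen k) * (4 * (1 - k) / (1 + k) ^ 3) / (1 + k) -
    ell (landen k) / (1 + k) ^ 2).
Proof.
intros Hk. assert (B := landen_bounds k Hk). unfold landen_flux_l.
rewrite ell_flux_eq by apply Rabs_unit, B. fold (ell' (landen k)).
generalize (ell' (landen k)) (ell (landen k)). intros e' e. unfold landen. field. lra.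
Qed.

Lemma landen_flux_r_eq (k : R) : 0 <= k < 1 ->
  2 * ell_flux (k ^ 2) = k * (1 - k ^ 2) * (2 * k * ell' (k ^ 2)).
Proof. intros Hk. rewrite ell_flux_eq by (apply Rabs_unit; nra). unfold ell'. ring. Qed.

(* Both sides [y] of the Landen transformation satisfy the self-adjoint equation
   [(k * (1 - k ^ 2) * y')' = k * y], so their weighted Wronskian is constant. *)
Lemma landen_wronskian (k : R) : 0 < k < 1 ->
  landen_flux_l k * ell (k ^ 2) = ell (landen k) / (1 + k) * (2 * ell_flux (k ^ 2)).
Proof.
intros Hk.
set (W := fun k => landen_flux_l k * ell (k ^ 2) - ell (landen k) / (1 + k) * (2 * ell_flux (k ^
  2))).
assert (C : forall x, 0 <= x < 1 -> continuity_pt landen_flux_l x).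
{ intros x Hx. assert (B := landen_bounds x Hx).
  assert (continuity_pt (fun k => ell_flux (landen k)) x).
  { eapply continuity_pt_of_is_derive, (is_derive_scale_comp ell_flux landen).
    apply is_derive_ell_flux, Rabs_unit, B. apply is_derive_landen; lra. }
  assert (continuity_pt (fun k => ell (landen k)) x).
  { eapply continuity_pt_of_is_derive, (is_derive_scale_comp ell landen).
    apply is_derive_ell, Rabs_unit, B. apply is_derive_landen; lra. }
  apply (continuity_pt_minus (fun k => (1 + k) * ell_flux (landen k)) (fun k => k * (1 - k) / (1 +
    k) * ell (landen k)));
  apply continuity_pt_mult; trivial; apply derivable_continuous_pt, ex_derive_Reals_0; auto_derive;
    lra. }
assert (CW : forall x, 0 <= x < 1 -> continuity_pt W x).
{ intros x Hx. apply continuity_pt_minus; apply continuity_pt_mult; auto.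
  - eapply continuity_pt_of_is_derive, is_derive_landen_r, Hx.
  - eapply continuity_pt_of_is_derive, is_derive_landen_l, Hx.
  - eapply continuity_pt_of_is_derive, is_derive_landen_flux_r, Hx. }
assert (E : W k = W 0).
{ apply is_derive_zero_const; try apply CW; try lra. intros x Hx. unfold W.
  evar_last.
  apply (is_derive_minus (fun k => landen_flux_l k * ell (k ^ 2)) (fun k => ell (landen k) / (1 +
    k) * (2 * ell_flux (k ^ 2)))).
  - apply (is_derive_mult landen_flux_l (fun k => ell (k ^ 2))).
    apply is_derive_landen_flux_l; lra. apply is_derive_landen_r; lra. intros; apply Rmult_comm.
  - apply (is_derive_mult (fun k => ell (landen k) / (1 + k)) (fun k => 2 * ell_flux (k ^ 2))).
    apply is_derive_landen_l; lra. apply is_derive_landen_flux_r; lra. intros; apply Rmult_comm.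
  - unfold minus, plus, opp, mult; simpl. rewrite landen_flux_l_eq by lra.
    change (x * (x * 1)) with (x ^ 2).
    rewrite landen_flux_r_eq by lra. field. lra. }
unfold W at 2 in E. unfold landen_flux_l in E at 1.
replace (landen 0) with 0 in E by (unfold landen; field).
replace (0 ^ 2) with 0 in E by ring. rewrite ell_flux_0 in E. unfold W in E. lra.
Qed.

(** The vanishing Wronskian makes the derivative of the quotient of both sides zero, and the
    quotient is 1 at 0. *)
Lemma ell_landen (k : R) : 0 <= k < 1 -> ell (landen k) = (1 + k) * ell (k ^ 2).
Proof.
intros [[Hk|<-] H1].
2: { replace (landen 0) with 0 by (unfold landen; field). replace (0 ^ 2) with 0 by ring. ring. }
assert (P : forall x, 0 <= x < 1 -> 1 <= ell (x ^ 2)) by (intros; apply ell_ge_1; nra).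
set (Q := fun k => ell (landen k) / (1 + k) / ell (k ^ 2)).
assert (D : forall x, 0 <= x < 1 -> is_derive Q x
  (((ell' (landen x) * (4 * (1 - x) / (1 + x) ^ 3) / (1 + x) - ell (landen x) / (1 + x) ^ 2) * ell
    (x ^ 2)
     - ell (landen x) / (1 + x) * (2 * x * ell' (x ^ 2))) / (ell (x ^ 2)) ^ 2)).
{ intros x Hx. apply (is_derive_div (fun k => ell (landen k) / (1 + k)) (fun k => ell (k ^ 2))).
  apply is_derive_landen_l, Hx. apply is_derive_landen_r, Hx.
  specialize (P x Hx). lra. }
assert (E : Q k = Q 0).
{ apply is_derive_zero_const; trivial.
  - intros x Hx. evar_last. apply D; lra.
    assert (Z : x * (1 - x ^ 2) * ((ell' (landen x) * (4 * (1 - x) / (1 + x) ^ 3) / (1 + x) - ell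
      (landen x) / (1 + x) ^ 2) * ell (x ^ 2)
     - ell (landen x) / (1 + x) * (2 * x * ell' (x ^ 2))) = 0).
    { generalize (landen_wronskian x ltac:(lra)).
      rewrite landen_flux_l_eq, landen_flux_r_eq by lra. lra. }
    apply Rmult_integral in Z. destruct Z as [Z|Z].
    + apply Rmult_integral in Z. destruct Z; nra.
    + rewrite Z. unfold Rdiv. ring.
  - eapply continuity_pt_of_is_derive, D; lra.
  - eapply continuity_pt_of_is_derive, D; lra. }
unfold Q in E. replace (landen 0) with 0 in E by (unfold landen; field).
replace (0 ^ 2) with 0 in E by ring. rewrite ell_0 in E.
specialize (P k ltac:(lra)).
replace (ell (landen k)) with (ell (landen k) / (1 + k) / ell (k ^ 2) * ((1 + k) * ell (k ^ 2))) by
  (field; lra).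
rewrite E. field.
Qed.

(** * The period ratio: uniqueness of the modulus, Landen doubling and asymptotics *)

Definition period_ratio (k : R) : R := ell (1 - k ^ 2) / ell (k ^ 2).

Lemma period_ratio_decreasing (x y : R) : 0 < x < y -> y < 1 -> period_ratio y < period_ratio x.
Proof.
intros Hx Hy. unfold period_ratio.
assert (ell (x ^ 2) < ell (y ^ 2)) by (apply ell_increasing; nra).
assert (ell (1 - y ^ 2) < ell (1 - x ^ 2)) by (apply ell_increasing; nra).
assert (1 <= ell (x ^ 2)) by (apply ell_ge_1; nra).
assert (1 <= ell (1 - y ^ 2)) by (apply ell_ge_1; nra).
apply Rlt_trans with (ell (1 - y ^ 2) / ell (x ^ 2)).
- apply Rmult_lt_compat_l. lra. apply Rinv_lt_contravar; trivial. apply Rmult_lt_0_compat; lra.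
- apply Rmult_lt_compat_r; trivial. apply Rinv_0_lt_compat. lra.
Qed.

Lemma elliptic_K_ratio (k : R) : 0 < k < 1 ->
  elliptic_K (sqrt (1 - k ^ 2)) / elliptic_K k = period_ratio k.
Proof.
intros Hk. unfold elliptic_K, period_ratio. rewrite pow2_sqrt by nra. rewrite !hyp2F1_half.
fold (ell (1 - k ^ 2)) (ell (k ^ 2)).
assert (1 <= ell (k ^ 2)) by (apply ell_ge_1; nra). generalize PI_RGT_0; intros.
field. lra.
Qed.

(** The given [k] supplies the existence that [epsilon_spec] needs; the strictly decreasing period
    ratio then leaves no other value. *)
Lemma singular_modulus_unique (r k : R) :
  0 < k < 1 -> period_ratio k = sqrt r -> singular_modulus r = k.
Proof.
intros Hk E.
assert (S : is_singular_modulus r k).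
{ split; trivial. rewrite elliptic_K_ratio; trivial. }
assert (S' := epsilon_spec (inhabits 0) (is_singular_modulus r) (ex_intro _ k S)).
fold (singular_modulus r) in S'. destruct S' as [H1 H2]. rewrite elliptic_K_ratio in H2 by trivial.
destruct (Rtotal_order (singular_modulus r) k) as [L|[L|L]]; trivial.
- generalize (period_ratio_decreasing (singular_modulus r) k). lra.
- generalize (period_ratio_decreasing k (singular_modulus r)). lra.
Qed.

(* [k = 2 sqrt k1 / (1 + k1)] is the ascending Landen step, and [(1 - k) / (1 + k)] is
   the same step for the complementary moduli. *)
Lemma period_ratio_landen (k k1 : R) :
  0 < k < 1 -> 0 < k1 < 1 -> k ^ 2 = landen k1 -> period_ratio k1 = 2 * period_ratio k.
Proof.
intros Hk Hk1 E. unfold period_ratio. rewrite E, ell_landen by lra.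
set (k' := (1 - k1) / (1 + k1)).
assert (Hk' : 0 < k' < 1).
{ unfold k'. split. apply Rdiv_lt_0_compat; lra. apply Rlt_div_l; lra. }
replace (1 - landen k1) with (k' ^ 2) by (unfold k', landen; field; lra).
replace (1 - k1 ^ 2) with (landen k') by (unfold k', landen; field; lra).
rewrite ell_landen by lra. unfold k' at 1.
assert (1 <= ell (k1 ^ 2)) by (apply ell_ge_1; nra). field. lra.
Qed.

(** The numerator is near its logarithmic singularity for small [k], and the factor 2 is
    [ln (k ^ 2) = 2 ln k]. The denominator is at least 1 and is dropped above; below it is kept,
    since it tends to 1 with [k] tending to 0. *)
Lemma period_ratio_bounds (k : R) : 0 < k < 1 ->
  - 2 * ln k / PI / ell (k ^ 2) <= period_ratio k <= 1 - 2 * ln k / PI.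
Proof.
intros Hk. generalize PI_RGT_0; intros HP. unfold period_ratio.
assert (1 <= ell (k ^ 2)) by (apply ell_ge_1; nra).
assert (U := ell_upper (1 - k ^ 2) ltac:(nra)). assert (L := ell_lower (1 - k ^ 2) ltac:(nra)).
replace (1 - (1 - k ^ 2)) with (k ^ 2) in * by ring.
assert (E : ln (k ^ 2) = 2 * ln k) by (simpl; rewrite Rmult_1_r, ln_mult by lra; ring).
rewrite E in *. split.
- apply Rmult_le_compat_r. apply Rlt_le, Rinv_0_lt_compat; lra.
  replace (-2 * ln k / PI) with (- (2 * ln k) / PI) by (field; lra). trivial.
- apply Rle_trans with (ell (1 - k ^ 2)); trivial.
  assert (1 <= ell (1 - k ^ 2)) by (apply ell_ge_1; nra).
  apply Rle_div_l. lra. nra.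
Qed.

(* The Landen iteration doubles the period ratio, so the logarithmic asymptotics of [K] at
   [1] determine it. *)
Lemma period_ratio_limit (k : nat -> R) (q c : R) :
  0 < q < 1 -> 0 < c -> (forall n, 0 < k n < 1) ->
  (forall n, (k n) ^ 2 = landen (k (S n))) ->
  (forall n, / c <= k n / sqrt (q ^ (2 ^ n)) <= c) ->
  period_ratio (k 0%nat) = - ln q / PI.
Proof.
intros Hq Hc Hk HL Hb. generalize PI_RGT_0; intros HP.
assert (R2 : forall n, period_ratio (k n) = 2 ^ n * period_ratio (k 0%nat)).
{ induction n as [|n IH]. simpl; ring.
  rewrite (period_ratio_landen (k n)), IH by auto. simpl; ring. }
assert (P2 : forall n, 0 < 2 ^ n) by (intros; apply pow_lt; lra).
assert (Pq : forall n, 0 < q ^ (2 ^ n)) by (intros; apply pow_lt; lra).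
(* The distance of [ln (k n)] from [ln (q ^ (2 ^ n)) / 2] is bounded uniformly in [n], hence
   disappears after division by [2 ^ n]. *)
assert (Hln : forall n, Rabs (ln (k n) - 2 ^ n * (ln q / 2)) <= Rabs (ln c)).
{ intros n. assert (S := sqrt_lt_R0 _ (Pq n)). assert (X := Hb n). specialize (Hk n).
  replace (2 ^ n * (ln q / 2)) with (ln (sqrt (q ^ (2 ^ n)))).
  - rewrite <- ln_div by lra.
    assert (0 < / c) by (apply Rinv_0_lt_compat; lra).
    assert (ln (/ c) <= ln (k n / sqrt (q ^ 2 ^ n))) by (apply ln_le; lra).
    assert (ln (k n / sqrt (q ^ 2 ^ n)) <= ln c) by (apply ln_le; lra).
    rewrite ln_Rinv in H0 by trivial. apply Rabs_le_between.
    generalize (Rle_abs (ln c)). lra.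
  - rewrite <- Rpower_sqrt, ln_Rpower by trivial. rewrite ln_pow by lra. rewrite pow_INR.
    simpl INR. change (1 + 1) with 2. field. }
assert (L0 : is_lim_seq (fun n => / 2 ^ n) 0).
{ apply is_lim_seq_ext with (fun n => (/ 2) ^ n). intros; rewrite pow_inv; trivial.
  apply is_lim_seq_geom. rewrite Rabs_pos_eq; lra. }
assert (LN : is_lim_seq (fun n => ln (k n) / 2 ^ n) (ln q / 2)).
{ apply is_lim_seq_le_le with (fun n => ln q / 2 - Rabs (ln c) * / 2 ^ n) (fun n => ln q / 2 + Rabs
  (ln c) * / 2 ^ n).
  - intros n. specialize (Hln n). specialize (P2 n). apply Rabs_le_between in Hln.
    replace (ln q / 2 - Rabs (ln c) * / 2 ^ n) with ((2 ^ n * (ln q / 2) - Rabs (ln c)) / 2 ^ n) by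
      (field; lra).
    replace (ln q / 2 + Rabs (ln c) * / 2 ^ n) with ((2 ^ n * (ln q / 2) + Rabs (ln c)) / 2 ^ n) by
      (field; lra).
    assert (0 < / 2 ^ n) by (apply Rinv_0_lt_compat; trivial).
    split; apply Rmult_le_compat_r; lra.
  - replace (Finite (ln q / 2)) with (Finite (ln q / 2 - Rabs (ln c) * 0)) by (f_equal; ring).
    apply is_lim_seq_minus'. apply is_lim_seq_const. apply is_lim_seq_mult'; trivial.
    apply is_lim_seq_const.
  - replace (Finite (ln q / 2)) with (Finite (ln q / 2 + Rabs (ln c) * 0)) by (f_equal; ring).
    apply is_lim_seq_plus'. apply is_lim_seq_const. apply is_lim_seq_mult'; trivial.
    apply is_lim_seq_const. }
assert (LK : is_lim_seq k 0).
{ apply is_lim_seq_ext with (fun n => exp (ln (k n))). { intros n. apply exp_ln, Hk. }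
  apply (is_lim_comp_seq exp _ m_infty 0).
  apply is_lim_exp_m. exists 0%nat. intros; discriminate.
  apply is_lim_seq_ext with (fun n => ln (k n) / 2 ^ n * 2 ^ n).
  intros n. specialize (P2 n). field. lra.
  assert (ln q < 0) by (rewrite <- ln_1; apply ln_increasing; lra).
  eapply is_lim_seq_mult. apply LN. apply is_lim_seq_geom_p. lra.
  unfold is_Rbar_mult, Rbar_mult'. destruct (Rle_dec 0 (ln q / 2)); trivial. exfalso. lra. }
assert (LE : is_lim_seq (fun n => ell (k n ^ 2)) 1).
{ replace (Finite 1) with (Finite (ell (0 ^ 2))) by (f_equal; replace (0 ^ 2) with 0 by ring; apply
  ell_0).
  apply (is_lim_seq_continuous (fun y => ell (y ^ 2))); trivial.
  eapply continuity_pt_of_is_derive, is_derive_landen_r. lra. }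
(* The initial ratio is [period_ratio (k n) / 2 ^ n]; the two bounds on it share the limit
   [- ln q / PI]. *)
apply Rle_antisym.
- apply (is_lim_seq_le (fun _ => period_ratio (k 0%nat)) (fun n => / 2 ^ n - 2 / PI * (ln (k n) / 2
  ^ n)) (period_ratio (k 0%nat)) (- ln q / PI)).
  + intros n. destruct (period_ratio_bounds (k n) (Hk n)) as [_ H]. rewrite R2 in H.
    specialize (P2 n).
    replace (/ 2 ^ n - 2 / PI * (ln (k n) / 2 ^ n)) with ((1 - 2 * ln (k n) / PI) / 2 ^ n) by
      (field; lra).
    apply (Rle_div_r (period_ratio (k 0%nat))); lra.
  + apply is_lim_seq_const.
  + replace (- ln q / PI) with (0 - 2 / PI * (ln q / 2)) by (field; lra).
    apply is_lim_seq_minus'; trivial. apply is_lim_seq_mult'; trivial. apply is_lim_seq_const.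
- apply (is_lim_seq_le (fun n => - (2 / PI) * (ln (k n) / 2 ^ n) / ell (k n ^ 2)) (fun _ =>
  period_ratio (k 0%nat)) (- ln q / PI) (period_ratio (k 0%nat))).
  + intros n. destruct (period_ratio_bounds (k n) (Hk n)) as [H _]. rewrite R2 in H.
    specialize (P2 n).
    assert (1 <= ell (k n ^ 2)) by (specialize (Hk n); apply ell_ge_1; nra).
    replace (- (2 / PI) * (ln (k n) / 2 ^ n) / ell (k n ^ 2)) with ((-2 * ln (k n) / PI / ell (k n
      ^ 2)) / 2 ^ n) by (field; lra).
    apply (Rle_div_l _ (period_ratio (k 0%nat))); lra.
  + replace (- ln q / PI) with (- (2 / PI) * (ln q / 2) / 1) by (field; lra).
    apply is_lim_seq_div'. 2: exact LE. 2: apply R1_neq_R0.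
    apply is_lim_seq_mult'; trivial. apply is_lim_seq_const.
  + apply is_lim_seq_const.
Qed.

(** * Bilateral series and infinite products *)

Definition bsum (a : Z -> R) : R :=
  Series (fun n => a (Z.of_nat n)) + Series (fun n => a (- Z.of_nat (S n))%Z).

(** Absolute convergence of both halves, the form that survives splitting by parity and comparison
    with a dominating family. *)
Definition bsummable (a : Z -> R) : Prop :=
  ex_series (fun n => Rabs (a (Z.of_nat n))) /\
  ex_series (fun n => Rabs (a (- Z.of_nat (S n))%Z)).

Lemma bsummable_is_bilateral_series (a : Z -> R) :
  bsummable a -> is_bilateral_series a (bsum a).
Proof.
intros [H1 H2].
exists (Series (fun n => a (Z.of_nat n))), (Series (fun n => a (- Z.of_nat (S n))%Z)).
split. apply Series_correct, ex_series_Rabs, H1. split; trivial.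
apply Series_correct, (ex_series_Rabs _ H2).
Qed.

Lemma bsum_ext (a b : Z -> R) : (forall n, a n = b n) -> bsum a = bsum b.
Proof. intros H. unfold bsum. f_equal; apply Series_ext; intros n; apply H. Qed.

Lemma bsummable_le (a b : Z -> R) :
  (forall n, Rabs (a n) <= b n) -> bsummable b -> bsummable a.
Proof.
intros H [H1 H2]. split.
- apply (ex_series_le (V := R_CompleteNormedModule) _ (fun n => Rabs (b (Z.of_nat n)))); trivial.
  intros n. unfold norm; simpl; unfold abs; simpl. rewrite Rabs_Rabsolu.
  apply Rle_trans with (1 := H _). apply Rle_abs.
- apply (ex_series_le (V := R_CompleteNormedModule) _ (fun n => Rabs (b (- Z.of_nat (S n))%Z)));
  trivial.
  intros n. unfold norm; simpl norm; unfold abs; simpl abs. rewrite Rabs_Rabsolu.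
  apply Rle_trans with (1 := H _). apply Rle_abs.
Qed.

Lemma bsummable_ext (a b : Z -> R) : (forall n, a n = b n) -> bsummable a -> bsummable b.
Proof.
intros H [H1 H2]. split; [eapply ex_series_ext; [|apply H1]|eapply ex_series_ext; [|apply H2]];
intros n; cbv beta; f_equal; apply H.
Qed.

Lemma bsummable_scal (c : R) (a : Z -> R) : bsummable a -> bsummable (fun n => c * a n).
Proof.
intros [H1 H2]. split.
- apply (ex_series_ext (fun n => Rabs c * Rabs (a (Z.of_nat n)))).
  intros; symmetry; apply Rabs_mult.
  apply (ex_series_scal_l (K := R_AbsRing) (V := R_NormedModule) (Rabs c)), H1.
- apply (ex_series_ext (fun n => Rabs c * Rabs (a (- Z.of_nat (S n))%Z))).
  intros; symmetry; apply Rabs_mult.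
  apply (ex_series_scal_l (K := R_AbsRing) (V := R_NormedModule) (Rabs c) _ H2).
Qed.

Lemma bsummable_plus (a b : Z -> R) : bsummable a -> bsummable b -> bsummable (fun n => a n + b n).
Proof.
intros [H1 H2] [G1 G2]. split.
- apply (ex_series_le (V := R_CompleteNormedModule) _ (fun n => Rabs (a (Z.of_nat n)) + Rabs (b
  (Z.of_nat n)))).
  intros n. unfold norm; simpl norm; unfold abs; simpl abs. rewrite Rabs_Rabsolu. apply Rabs_triang.
  apply (ex_series_plus (V := R_NormedModule) _ _ H1 G1).
- apply (ex_series_le (V := R_CompleteNormedModule) _ (fun n => Rabs (a (- Z.of_nat (S n))%Z) +
  Rabs (b (- Z.of_nat (S n))%Z))).
  intros n. unfold norm; simpl norm; unfold abs; simpl abs. rewrite Rabs_Rabsolu. apply Rabs_triang.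
  apply (ex_series_plus (V := R_NormedModule) _ _ H2 G2).
Qed.

Lemma bsum_scal (c : R) (a : Z -> R) : bsum (fun n => c * a n) = c * bsum a.
Proof. unfold bsum. rewrite !Series_scal_l. ring. Qed.

Lemma bsum_plus (a b : Z -> R) : bsummable a -> bsummable b ->
  bsum (fun n => a n + b n) = bsum a + bsum b.
Proof.
intros [H1 H2] [G1 G2]. unfold bsum.
rewrite Series_plus by (apply ex_series_Rabs; trivial).
rewrite Series_plus. ring. apply (ex_series_Rabs _ H2). apply (ex_series_Rabs _ G2).
Qed.

(** Only the term [a 0] passes from one half to the other. *)
Lemma bsum_shift (a : Z -> R) : bsummable a ->
  bsummable (fun n => a (n + 1)%Z) /\ bsum (fun n => a (n + 1)%Z) = bsum a.
Proof.
intros [H1 H2].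
assert (E1 : forall n, a (Z.of_nat (S n)) = a (Z.of_nat n + 1)%Z) by (intros; f_equal; lia).
assert (E2 : forall n, a (- Z.of_nat (S n) + 1)%Z = a (- Z.of_nat n)%Z) by (intros; f_equal; lia).
assert (G2 : ex_series (fun n => Rabs (a (- Z.of_nat n)%Z))).
{ apply ex_series_incr_1, H2. }
split; [split|].
- apply (ex_series_ext (fun n => Rabs (a (Z.of_nat (S n))))). intros; rewrite E1; trivial.
  apply (ex_series_incr_1 (fun n => Rabs (a (Z.of_nat n)))), H1.
- apply (ex_series_ext (fun n => Rabs (a (- Z.of_nat n)%Z))). intros; rewrite E2; trivial. trivial.
- unfold bsum.
  rewrite (Series_incr_1 (fun n => a (Z.of_nat n))) by (apply ex_series_Rabs, H1).
  rewrite (Series_ext (fun n => a (- Z.of_nat (S n) + 1)%Z) (fun n => a (- Z.of_nat n)%Z)) by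
    trivial.
  rewrite (Series_incr_1 (fun n => a (- Z.of_nat n)%Z)) by (apply ex_series_Rabs, G2).
  rewrite (Series_ext (fun n => a (Z.of_nat (S n))) (fun n => a (Z.of_nat n + 1)%Z)) by trivial.
  change (- Z.of_nat 0)%Z with 0%Z. change (Z.of_nat 0)%Z with 0%Z. ring.
Qed.

Lemma bsum_shift_pred (a : Z -> R) : bsummable a ->
  bsummable (fun n => a (n - 1)%Z) /\ bsum (fun n => a (n - 1)%Z) = bsum a.
Proof.
intros [H1 H2].
assert (B : bsummable (fun n => a (n - 1)%Z)).
{ split.
  - apply ex_series_incr_1. apply (ex_series_ext (fun n => Rabs (a (Z.of_nat n)))); trivial.
    intros n. do 2 f_equal. lia.
  - apply (ex_series_ext (fun n => Rabs (a (- Z.of_nat (S (S n)))%Z))).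
    intros n. do 2 f_equal. lia.
    apply (ex_series_incr_1 (fun n => Rabs (a (- Z.of_nat (S n))%Z))), H2. }
split; trivial. rewrite <- (proj2 (bsum_shift _ B)). apply bsum_ext. intros n. f_equal. lia.
Qed.

(** A partial sum of [2 n + 2] terms splits exactly into [n + 1] even and [n + 1] odd ones; absolute
    convergence makes both subseries converge. *)
Lemma Series_even_odd (a : nat -> R) : ex_series (fun n => Rabs (a n)) ->
  (ex_series (fun n => Rabs (a (2 * n)%nat)) /\ ex_series (fun n => Rabs (a (2 * n + 1)%nat))) /\
  Series a = Series (fun n => a (2 * n)%nat) + Series (fun n => a (2 * n + 1)%nat).
Proof.
intros H.
assert (S2 : forall (b : nat -> R) n, sum_n b (2 * n + 1) = sum_n (fun k => b (2 * k)%nat) n +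
  sum_n (fun k => b (2 * k + 1)%nat) n).
{ intros b. induction n as [|n IH].
  - simpl. rewrite sum_Sn, !sum_O. reflexivity.
  - replace (2 * S n + 1)%nat with (S (S (2 * n + 1))) by lia. rewrite !sum_Sn, IH.
    replace (S (2 * n + 1)) with (2 * S n)%nat by lia.
    replace (S (2 * S n)) with (2 * S n + 1)%nat by lia.
    unfold plus; simpl. ring. }
assert (B : forall f : nat -> nat, (forall n, sum_n (fun k => Rabs (a (f k))) n <= sum_n (fun k =>
  Rabs (a k)) (2 * n + 1)) ->
  ex_series (fun n => Rabs (a (f n)))).
{ intros f Hf. apply ex_finite_lim_seq_incr with (M := Series (fun n => Rabs (a n))).
  - intros n. rewrite sum_Sn. unfold plus; simpl. generalize (Rabs_pos (a (f (S n)))). lra.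
  - intros n. apply Rle_trans with (1 := Hf n).
    apply (is_lim_seq_incr_compare (sum_n (fun k => Rabs (a k)))).
    apply (Series_correct _ H).
    intros m. rewrite sum_Sn. unfold plus; simpl. generalize (Rabs_pos (a (S m))). lra. }
assert (N : forall (f : nat -> nat) n, 0 <= sum_n (fun k => Rabs (a (f k))) n).
{ intros f. induction n. rewrite sum_O. apply Rabs_pos.
  rewrite sum_Sn. unfold plus; simpl. generalize (Rabs_pos (a (f (S n)))). lra. }
assert (HE : ex_series (fun n => Rabs (a (2 * n)%nat))).
{ apply (B (fun n => (2 * n)%nat)). intros n. rewrite S2.
  generalize (N (fun n => (2 * n + 1)%nat) n). lra. }
assert (HO : ex_series (fun n => Rabs (a (2 * n + 1)%nat))).
{ apply (B (fun n => (2 * n + 1)%nat)). intros n. rewrite S2.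
  generalize (N (fun n => (2 * n)%nat) n). lra. }
split; [split; trivial|].
assert (L : is_lim_seq (fun n => sum_n a (2 * n + 1)) (Series a)).
{ apply (is_lim_seq_subseq (sum_n a) _ (fun n => (2 * n + 1)%nat)).
  apply eventually_subseq. intros; lia. apply (Series_correct a), ex_series_Rabs, H. }
assert (L' : is_lim_seq (fun n => sum_n a (2 * n + 1)) (Series (fun n => a (2 * n)%nat) + Series
  (fun n => a (2 * n + 1)%nat))).
{ eapply is_lim_seq_ext. intros n. symmetry. apply S2.
  apply is_lim_seq_plus'. apply (Series_correct (fun n => a (2 * n)%nat)), (ex_series_Rabs _ HE).
  apply (Series_correct (fun n => a (2 * n + 1)%nat)), (ex_series_Rabs _ HO). }
apply is_lim_seq_unique in L. apply is_lim_seq_unique in L'. rewrite L in L'. injection L'. trivial.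
Qed.

Lemma bsum_even_odd (a : Z -> R) : bsummable a ->
  (bsummable (fun n => a (2 * n)%Z) /\ bsummable (fun n => a (2 * n + 1)%Z)) /\
  bsum a = bsum (fun n => a (2 * n)%Z) + bsum (fun n => a (2 * n + 1)%Z).
Proof.
intros [H1 H2].
destruct (Series_even_odd _ H1) as [[X1 X2] X3].
destruct (Series_even_odd _ H2) as [[Y1 Y2] Y3].
assert (E1 : forall n, a (Z.of_nat (2 * n)) = a (2 * Z.of_nat n)%Z) by (intros; f_equal; lia).
assert (E2 : forall n, a (Z.of_nat (2 * n + 1)) = a (2 * Z.of_nat n + 1)%Z) by (intros; f_equal;
  lia).
assert (E3 : forall n, a (- Z.of_nat (S (2 * n)))%Z = a (2 * - Z.of_nat (S n) + 1)%Z) by (intros;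
  f_equal; lia).
assert (E4 : forall n, a (- Z.of_nat (S (2 * n + 1)))%Z = a (2 * - Z.of_nat (S n))%Z) by (intros;
  f_equal; lia).
split; [split; split|].
- eapply ex_series_ext, X1. intros n. cbv beta. rewrite E1. trivial.
- eapply ex_series_ext, Y2. intros n. cbv beta. rewrite E4. trivial.
- eapply ex_series_ext, X2. intros n. cbv beta. rewrite E2. trivial.
- eapply ex_series_ext, Y1. intros n. cbv beta. rewrite E3. trivial.
- unfold bsum. rewrite X3, Y3.
  rewrite (Series_ext _ _ E1), (Series_ext _ _ E2), (Series_ext _ _ E3), (Series_ext _ _ E4). ring.
Qed.

(** Tannery's theorem: beyond a fixed index every tail is at most the tail of [g], and the finite
    sum that remains converges termwise. *)
Lemma Series_dominated_lim (a : nat -> nat -> R) (l g : nat -> R) :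
  ex_series g -> (forall N n, Rabs (a N n) <= g n) ->
  (forall n, is_lim_seq (fun N => a N n) (l n)) ->
  is_lim_seq (fun N => Series (a N)) (Series l).
Proof.
intros Hg Hd Hl.
assert (Hlg : forall n, Rabs (l n) <= g n).
{ intros n. apply (is_lim_seq_le (fun N => Rabs (a N n)) (fun _ => g n) (Rabs (l n)) (g n)).
  - intros N. apply Hd.
  - apply (is_lim_seq_abs _ (l n)), Hl.
  - apply is_lim_seq_const. }
assert (EX : forall b : nat -> R, (forall n, Rabs (b n) <= g n) -> ex_series b).
{ intros b Hb. apply (ex_series_le (V := R_CompleteNormedModule) _ g); trivial. }
assert (EA : forall b : nat -> R, (forall n, Rabs (b n) <= g n) -> ex_series (fun n => Rabs (b n))).
{ intros b Hb. apply EX. intros n. rewrite Rabs_Rabsolu. trivial. }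
assert (T : forall (b : nat -> R) M, (forall n, Rabs (b n) <= g n) ->
  Rabs (Series b - sum_n b M) <= Series g - sum_n g M).
{ intros b M Hb.
  rewrite (Series_incr_n b (S M)), (Series_incr_n g (S M)); auto; try lia.
  rewrite <- !sum_n_Reals. simpl Init.Nat.pred.
  replace (sum_n b M + Series (fun k => b (S M + k)%nat) - sum_n b M) with (Series (fun k => b (S M
    + k)%nat)) by ring.
  replace (sum_n g M + Series (fun k => g (S M + k)%nat) - sum_n g M) with (Series (fun k => g (S M
    + k)%nat)) by ring.
  assert (EG : ex_series (fun k => g (S M + k)%nat)) by (apply ex_series_incr_n, Hg).
  apply Rle_trans with (Series (fun k => Rabs (b (S M + k)%nat))).
  - apply Series_Rabs.
    apply (ex_series_le (V := R_CompleteNormedModule) _ (fun k => g (S M + k)%nat)); trivial.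
    intros n. unfold norm; simpl norm; unfold abs; simpl abs. rewrite Rabs_Rabsolu. apply Hb.
  - apply Series_le; trivial. intros n. split. apply Rabs_pos. apply Hb. }
assert (LS : forall M, is_lim_seq (fun N => sum_n (a N) M) (sum_n l M)).
{ induction M as [|M IH].
  - rewrite sum_O. apply is_lim_seq_ext with (fun N => a N 0%nat). intros; symmetry; apply sum_O.
    apply Hl.
  - rewrite sum_Sn. apply is_lim_seq_ext with (fun N => plus (sum_n (a N) M) (a N (S M))).
    intros; symmetry; apply sum_Sn.
    apply is_lim_seq_plus'; trivial. }
apply is_lim_seq_spec. intros eps.
assert (LG := Series_correct g Hg).
assert (LG' : is_lim_seq (sum_n g) (Series g)) by exact LG.
apply is_lim_seq_spec in LG'.
assert (P3 : 0 < eps / 3) by (generalize (cond_pos eps); lra).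
destruct (LG' (mkposreal _ P3)) as [M HM]. specialize (HM M (le_n M)). simpl in HM.
specialize (LS M). apply is_lim_seq_spec in LS. destruct (LS (mkposreal _ P3)) as [N0 HN].
simpl in HN.
exists N0. intros N HN0. specialize (HN N HN0).
assert (T1 := T (a N) M (Hd N)). assert (T2 := T l M Hlg).
apply Rabs_def2 in HM. apply Rabs_def2 in HN.
apply Rabs_le_between in T1. apply Rabs_le_between in T2. apply Rabs_def1; lra.
Qed.

Lemma bsum_dominated_lim (a : nat -> Z -> R) (l g : Z -> R) :
  bsummable g -> (forall N n, Rabs (a N n) <= g n) ->
  (forall n, is_lim_seq (fun N => a N n) (l n)) ->
  is_lim_seq (fun N => bsum (a N)) (bsum l).
Proof.
intros [G1 G2] Hd Hl. unfold bsum. apply is_lim_seq_plus'.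
- apply (Series_dominated_lim (fun N n => a N (Z.of_nat n)) _ (fun n => g (Z.of_nat n))); auto.
  apply ex_series_Rabs, G1.
- apply (Series_dominated_lim (fun N n => a N (- Z.of_nat (S n))%Z) _ (fun n => g (- Z.of_nat (S
  n))%Z)); auto.
  apply (ex_series_Rabs _ G2).
Qed.

(** * Finite products and Euler's product as their limit *)

(** The empty product is available at [N = 0], so inductions start from 1; [prod_f_R0] with the same
    bound has one factor more. *)
Fixpoint pprod (u : nat -> R) (N : nat) : R :=
  match N with
  | O => 1
  | S M => pprod u M * u M
  end.

Lemma pprod_ext (u v : nat -> R) (N : nat) : (forall n, u n = v n) -> pprod u N = pprod v N.
Proof. intros H. induction N as [|N IH]; simpl; congruence. Qed.

Lemma pprod_mult (u v : nat -> R) (N : nat) : pprod (fun n => u n * v n) N = pprod u N * pprod v N.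
Proof. induction N as [|N IH]; simpl. ring. rewrite IH. ring. Qed.

Lemma pprod_even_odd (u : nat -> R) (N : nat) :
  pprod u (2 * N) = pprod (fun n => u (2 * n)%nat) N * pprod (fun n => u (2 * n + 1)%nat) N.
Proof.
induction N as [|N IH]. simpl; ring.
replace (2 * S N)%nat with (S (S (2 * N))) by lia.
change (pprod u (S (S (2 * N)))) with (pprod u (2 * N) * u (2 * N)%nat * u (S (2 * N))).
rewrite IH. replace (S (2 * N)) with (2 * N + 1)%nat by lia. cbn [pprod]. ring.
Qed.

Lemma pprod_incr_1 (u : nat -> R) (N : nat) : pprod u (S N) = u 0%nat * pprod (fun n => u (S n)) N.
Proof. induction N as [|N IH]. simpl; ring. simpl in *. rewrite IH. ring. Qed.

Lemma pprod_pos (u : nat -> R) (N : nat) : (forall n, 0 < u n) -> 0 < pprod u N.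
Proof. intros H. induction N as [|N IH]; simpl. lra. apply Rmult_lt_0_compat; trivial. Qed.

Lemma pprod_le (u v : nat -> R) (N : nat) : (forall n, 0 < u n <= v n) -> pprod u N <= pprod v N.
Proof.
intros H. induction N as [|N IH]; simpl. lra.
destruct (H N). apply Rmult_le_compat; trivial; try lra. apply Rlt_le, pprod_pos. apply H.
Qed.

Definition eprod (y : R) (N : nat) : R := pprod (fun n => 1 - y ^ S n) N.

Lemma eprod_S (y : R) (N : nat) : eprod y (S N) = eprod y N * (1 - y ^ S N).
Proof. reflexivity. Qed.

Lemma pow_unit (y : R) (n : nat) : 0 < y < 1 -> 0 < y ^ S n < 1.
Proof.
intros H. split. apply pow_lt; lra. apply pow_lt_1_compat. lra. lia.
Qed.

Lemma eprod_pos (y : R) (N : nat) : 0 < y < 1 -> 0 < eprod y N.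
Proof. intros H. apply pprod_pos. intros n. generalize (pow_unit y n H). lra. Qed.

Lemma eprod_decr (y : R) (N M : nat) : 0 < y < 1 -> (N <= M)%nat -> eprod y M <= eprod y N.
Proof.
intros H L. induction L as [|M L IH]. lra.
apply Rle_trans with (2 := IH). rewrite eprod_S.
generalize (pow_unit y M H) (eprod_pos y M H). intros. nra.
Qed.

(* [1 - t >= exp (- t / (1 - t))] bounds the product below by the exponential of a geometric sum. *)
Lemma eprod_lower (y : R) (N : nat) : 0 < y < 1 -> exp (- y / (1 - y) ^ 2) <= eprod y N.
Proof.
intros H.
assert (P : 0 < (1 - y) ^ 2) by (apply pow_lt; lra).
apply Rle_trans with (exp (- (y * (1 - y ^ N)) / (1 - y) ^ 2)).
- destruct (Req_dec 0 (y ^ N)) as [E|E].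
  + rewrite <- E. apply Req_le. f_equal. unfold Rdiv. ring.
  + apply Rlt_le, exp_increasing. apply Rmult_lt_compat_r. apply Rinv_0_lt_compat, P.
    assert (0 < y ^ N) by (apply pow_lt; lra). nra.
- induction N as [|N IH].
  + change (eprod y 0) with 1. apply Req_le. transitivity (exp 0); [|apply exp_0]. f_equal. simpl.
    unfold Rdiv. ring.
  + rewrite eprod_S.
    generalize (pow_unit y N H). intros Q.
    replace (- (y * (1 - y ^ S N)) / (1 - y) ^ 2) with (- (y * (1 - y ^ N)) / (1 - y) ^ 2 + - (y ^
      S N / (1 - y))) by (simpl; field; lra).
    rewrite exp_plus. apply Rmult_le_compat; trivial; try apply Rlt_le, exp_pos.
    rewrite exp_Ropp. rewrite <- (Rinv_inv (1 - y ^ S N)).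
    apply Rinv_le_contravar. apply Rinv_0_lt_compat; lra.
    assert (L : y ^ S N / (1 - y ^ S N) <= y ^ S N / (1 - y)).
    { apply Rmult_le_compat_l. lra. apply Rinv_le_contravar. lra.
      simpl. generalize (pow_incr y 1 N ltac:(lra)) (pow_le y N ltac:(lra)). rewrite pow1. nra. }
    apply Rle_trans with (1 + y ^ S N / (1 - y ^ S N)).
    apply Req_le. field. lra.
    apply Rle_trans with (1 + y ^ S N / (1 - y)). lra. apply exp_ineq1_le.
Qed.

Lemma is_lim_eprod (y : R) : 0 < y < 1 -> is_lim_seq (eprod y) (eta y).
Proof.
intros H.
destruct (ex_finite_lim_seq_decr (eprod y) (exp (- y / (1 - y) ^ 2))) as [l Hl].
- intros n. apply eprod_decr; trivial. lia.
- intros n. apply eprod_lower, H.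
- replace (eta y) with l; trivial. unfold eta.
  (* The extra factor of [prod_f_R0] is an index shift, which the limit absorbs. *)
  assert (E : forall N, prod_f_R0 (fun n => 1 - y ^ S n) N = eprod y (S N)).
  { induction N as [|N IH]. unfold eprod; simpl; ring.
    change (prod_f_R0 (fun n => 1 - y ^ S n) (S N)) with (prod_f_R0 (fun n => 1 - y ^ S n) N * (1 -
      y ^ S (S N))).
    rewrite IH. reflexivity. }
  rewrite (Lim_seq_ext (fun N => prod_f_R0 (fun n => 1 - y ^ S n) N) (fun N => eprod y (S N)) E),
    Lim_seq_incr_1.
  rewrite (is_lim_seq_unique _ _ Hl). reflexivity.
Qed.

Lemma eta_pos (y : R) : 0 < y < 1 -> 0 < eta y.
Proof.
intros H. apply Rlt_le_trans with (exp (- y / (1 - y) ^ 2)). apply exp_pos.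
apply (is_lim_seq_le (fun _ => exp (- y / (1 - y) ^ 2)) (eprod y) (exp (- y / (1 - y) ^ 2)) (eta
  y)).
intros n. apply eprod_lower, H. apply is_lim_seq_const. apply is_lim_eprod, H.
Qed.

Lemma eta_le_eprod (y : R) (N : nat) : 0 < y < 1 -> eta y <= eprod y N.
Proof.
intros H. apply (is_lim_seq_decr_compare (eprod y)). apply is_lim_eprod, H.
intros n. apply eprod_decr; trivial. lia.
Qed.

Lemma eta_le_1 (y : R) : 0 < y < 1 -> eta y <= 1.
Proof. intros H. apply (eta_le_eprod y 0 H). Qed.

Lemma eta_antitone (x y : R) : 0 < x <= y -> y < 1 -> eta y <= eta x.
Proof.
intros H H1.
apply (is_lim_seq_le (eprod y) (eprod x) (eta y) (eta x)); try (apply is_lim_eprod; lra).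
intros n. apply pprod_le. intros m.
generalize (pow_unit y m ltac:(lra)) (pow_incr x y (S m) ltac:(lra)). lra.
Qed.

(** * The Jacobi triple product *)

(** The value 0 at negative indices makes Gaussian binomials vanish outside their range and lets the
    step [qfact_inv_pred] hold for every integer: at [k = 0] its factor [1 - y ^ 0] is zero. *)
Definition qfact_inv (y : R) (k : Z) : R :=
  if (k <? 0)%Z then 0 else / eprod y (Z.to_nat k).

Lemma qfact_inv_pred (y : R) (k : Z) : 0 < y < 1 ->
  qfact_inv y (k - 1) = (1 - powerRZ y k) * qfact_inv y k.
Proof.
intros H. unfold qfact_inv.
destruct (Z.ltb_spec (k - 1) 0) as [L|L]; destruct (Z.ltb_spec k 0) as [L'|L']; try lia.
- ring.
- replace k with 0%Z by lia. simpl. ring.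
- replace (Z.to_nat k) with (S (Z.to_nat (k - 1))) by lia. rewrite eprod_S.
  replace (powerRZ y k) with (y ^ S (Z.to_nat (k - 1))).
  + generalize (eprod_pos y (Z.to_nat (k - 1)) H) (pow_unit y (Z.to_nat (k - 1)) H). intros. field.
    lra.
  + rewrite pow_powerRZ. f_equal. lia.
Qed.

Lemma qfact_inv_bounds (y : R) (k : Z) (N : nat) : 0 < y < 1 -> (k <= Z.of_nat N)%Z ->
  0 <= eprod y N * qfact_inv y k <= 1.
Proof.
intros H L. unfold qfact_inv. destruct (Z.ltb_spec k 0) as [L'|L']. lra.
assert (P := eprod_pos y (Z.to_nat k) H). assert (Q := eprod_pos y N H).
assert (D := eprod_decr y (Z.to_nat k) N H ltac:(lia)). split.
- apply Rlt_le, Rmult_lt_0_compat; trivial. apply Rinv_0_lt_compat, P.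
- apply Rle_div_l; lra.
Qed.

Lemma is_lim_qfact_inv (y : R) (f : nat -> Z) : 0 < y < 1 ->
  (forall M, exists N0, forall N, (N0 <= N)%nat -> (Z.of_nat M <= f N)%Z) ->
  is_lim_seq (fun N => qfact_inv y (f N)) (/ eta y).
Proof.
intros H Hf. apply is_lim_seq_ext_loc with (fun N => / eprod y (Z.to_nat (f N))).
- destruct (Hf 0%nat) as [N0 HN]. exists N0. intros N L. specialize (HN N L).
  unfold qfact_inv. destruct (Z.ltb_spec (f N) 0); trivial. lia.
- apply (is_lim_seq_inv _ (eta y)).
  2: { intros E. injection E. generalize (eta_pos y H). lra. }
  apply (filterlim_comp _ _ _ (fun N => Z.to_nat (f N)) (eprod y) eventually eventually).
  + intros P [M HM]. destruct (Hf M) as [N0 HN]. exists N0. intros N L. apply HM.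
    specialize (HN N L). lia.
  + apply is_lim_eprod, H.
Qed.

(* [x ^ (n ^ 2)] times the Gaussian binomial coefficient [2 N choose N + n] in base [x ^ 2]. *)
Definition jtp_coef (x : R) (N : nat) (n : Z) : R :=
  eprod (x ^ 2) (2 * N) * qfact_inv (x ^ 2) (Z.of_nat N + n) * qfact_inv (x ^ 2) (Z.of_nat N - n)
    * powerRZ x (n * n).

Lemma sqr_unit (x : R) : 0 < x < 1 -> 0 < x ^ 2 < 1.
Proof. intros. nra. Qed.

(** Compares coefficients of [z ^ n] when the partial triple product is multiplied by its next
    factor [1 + x ^ (4 N + 2) + x ^ (2 N + 1) (z + 1 / z)]. *)
Lemma jtp_coef_S (x : R) (N : nat) (n : Z) : 0 < x < 1 ->
  jtp_coef x (S N) n = (1 + x ^ (4 * N + 2)) * jtp_coef x N n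
    + x ^ (2 * N + 1) * (jtp_coef x N (n - 1) + jtp_coef x N (n + 1)).
Proof.
intros Hx. assert (Hy := sqr_unit x Hx). unfold jtp_coef. set (y := x ^ 2) in *.
(* All reciprocals are expressed by the two of largest index, [U] and [V], stepping down with
   [qfact_inv_pred], which is valid for negative indices too; a rational identity remains. *)
set (U := qfact_inv y (Z.of_nat (S N) + n)). set (V := qfact_inv y (Z.of_nat (S N) - n)).
set (t := x ^ (2 * N + 2)). set (u := powerRZ x n). set (X := powerRZ x (n * n)).
assert (x0 : x <> 0) by lra. assert (y0 : y <> 0) by lra.
assert (u0 : u <> 0) by (apply powerRZ_NOR; trivial).
assert (yz : forall k, powerRZ y k = powerRZ x k * powerRZ x k).
{ intros k. unfold y. simpl. rewrite Rmult_1_r. apply powerRZ_mult. }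
assert (tz : forall k, powerRZ x (Z.of_nat (S N) + k) * powerRZ x (Z.of_nat (S N) + k) = t *
  (powerRZ x k * powerRZ x k)).
{ intros k. rewrite !powerRZ_add by trivial. rewrite <- !pow_powerRZ. unfold t.
  replace (2 * N + 2)%nat with (S N + S N)%nat by lia. rewrite pow_add. ring. }
assert (un : powerRZ x (- n) = / u) by apply powerRZ_neg'.
assert (u1 : powerRZ x (n - 1) = u / x).
{ unfold Z.sub. rewrite powerRZ_add by trivial. simpl. rewrite Rmult_1_r. reflexivity. }
assert (u1' : powerRZ x (- n - 1) = / u / x).
{ unfold Z.sub. rewrite powerRZ_add, un by trivial. simpl. rewrite Rmult_1_r. reflexivity. }
assert (EU : qfact_inv y (Z.of_nat N + n) = (1 - t * u * u) * U).
{ unfold U. replace (Z.of_nat N + n)%Z with (Z.of_nat (S N) + n - 1)%Z by lia.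
  rewrite qfact_inv_pred, yz, tz by trivial. fold u. ring. }
assert (EV : qfact_inv y (Z.of_nat N - n) = (1 - t / u / u) * V).
{ unfold V. replace (Z.of_nat N - n)%Z with (Z.of_nat (S N) + - n - 1)%Z by lia.
  rewrite qfact_inv_pred, yz, tz, un by trivial. unfold Z.sub. field. trivial. }
assert (EU1 : qfact_inv y (Z.of_nat N + (n - 1)) = (1 - t * u * u / x / x) * ((1 - t * u * u) * U)).
{ rewrite <- EU. replace (Z.of_nat N + (n - 1))%Z with (Z.of_nat N + n - 1)%Z by lia.
  rewrite qfact_inv_pred, yz by trivial.
  replace (Z.of_nat N + n)%Z with (Z.of_nat (S N) + (n - 1))%Z at 1 2 by lia. rewrite tz, u1.
  field. trivial. }
assert (EV1 : qfact_inv y (Z.of_nat N - (n + 1)) = (1 - t / u / u / x / x) * ((1 - t / u / u) * V)).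
{ rewrite <- EV. replace (Z.of_nat N - (n + 1))%Z with (Z.of_nat N - n - 1)%Z by lia.
  rewrite qfact_inv_pred, yz by trivial.
  replace (Z.of_nat N - n)%Z with (Z.of_nat (S N) + (- n - 1))%Z at 1 2 by lia. rewrite tz, u1'.
  field. split; trivial. }
assert (EU2 : qfact_inv y (Z.of_nat N + (n + 1)) = U) by (unfold U; f_equal; lia).
assert (EV2 : qfact_inv y (Z.of_nat N - (n - 1)) = V) by (unfold V; f_equal; lia).
assert (EX1 : powerRZ x ((n - 1) * (n - 1)) = X / u / u * x).
{ replace ((n - 1) * (n - 1))%Z with (n * n + (- n) + (- n) + 1)%Z by ring.
  rewrite !powerRZ_add, un, powerRZ_1 by trivial. unfold X. field. trivial. }
assert (EX2 : powerRZ x ((n + 1) * (n + 1)) = X * u * u * x).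
{ replace ((n + 1) * (n + 1))%Z with (n * n + n + n + 1)%Z by ring.
  rewrite !powerRZ_add, powerRZ_1 by trivial. reflexivity. }
rewrite EU, EV, EU1, EV1, EU2, EV2, EX1, EX2.
replace (2 * S N)%nat with (S (S (2 * N))) by lia. rewrite !eprod_S. set (P := eprod y (2 * N)).
replace (y ^ S (S (2 * N))) with (t * t).
2: { unfold t, y. rewrite <- pow_mult, <- pow_add. f_equal. lia. }
replace (y ^ S (2 * N)) with (t * t / x / x).
2: { unfold t, y. rewrite <- pow_mult, <- pow_add.
replace (2 * N + 2 + (2 * N + 2))%nat with (2 + 2 * S (2 * N))%nat by lia. rewrite (pow_add x 2).
field. trivial. }
replace (x ^ (4 * N + 2)) with (t * t / x / x).
2: { unfold t. rewrite <- pow_add.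
replace (2 * N + 2 + (2 * N + 2))%nat with (2 + (4 * N + 2))%nat by lia. rewrite (pow_add x 2).
field. trivial. }
replace (x ^ (2 * N + 1)) with (t / x).
2: { unfold t. replace (2 * N + 2)%nat with (1 + (2 * N + 1))%nat by lia. rewrite (pow_add x 1).
field. trivial. }
clearbody P t u X U V. field. split; trivial.
Qed.

Lemma jtp_coef_0 (x : R) (n : Z) : jtp_coef x 0 n = if (n =? 0)%Z then 1 else 0.
Proof.
unfold jtp_coef, qfact_inv. destruct (Z.eqb_spec n 0) as [->|E].
- unfold eprod; simpl. field.
- destruct (Z.ltb_spec (Z.of_nat 0 + n) 0). ring. destruct (Z.ltb_spec (Z.of_nat 0 - n) 0). ring.
  simpl in *; lia.
Qed.

(** The bound is uniform in [N] and serves as the dominating term. For [N + n >= 0] one reciprocal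
    is at most [/ eta (x ^ 2)] and the other is absorbed by the product of length [2 N], as
    [N - n <= 2 N]; otherwise the coefficient is zero. *)
Lemma jtp_coef_bound (x : R) (N : nat) (n : Z) : 0 < x < 1 ->
  0 <= jtp_coef x N n <= / eta (x ^ 2) * powerRZ x (n * n).
Proof.
intros Hx. assert (Hy := sqr_unit x Hx). unfold jtp_coef. set (y := x ^ 2) in *.
assert (X : 0 < powerRZ x (n * n)) by (apply powerRZ_lt; lra).
assert (E := eta_pos y Hy). assert (IE := Rinv_0_lt_compat _ E).
cut (0 <= eprod y (2 * N) * qfact_inv y (Z.of_nat N + n) * qfact_inv y (Z.of_nat N - n) <= / eta y).
{ intros [A B]. split. apply Rmult_le_pos; lra. apply Rmult_le_compat_r; lra. }
assert (Q : 0 <= qfact_inv y (Z.of_nat N + n) <= / eta y).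
{ unfold qfact_inv. destruct (Z.ltb_spec (Z.of_nat N + n) 0). lra.
  split. apply Rlt_le, Rinv_0_lt_compat, eprod_pos, Hy. apply Rinv_le_contravar; trivial.
  apply eta_le_eprod, Hy. }
destruct (Z_lt_le_dec (Z.of_nat N + n) 0) as [L|L].
{ unfold qfact_inv at 1 3. destruct (Z.ltb_spec (Z.of_nat N + n) 0); [|lia]. lra. }
assert (B := qfact_inv_bounds y (Z.of_nat N - n) (2 * N) Hy ltac:(lia)).
replace (eprod y (2 * N) * qfact_inv y (Z.of_nat N + n) * qfact_inv y (Z.of_nat N - n))
  with (qfact_inv y (Z.of_nat N + n) * (eprod y (2 * N) * qfact_inv y (Z.of_nat N - n))) by ring.
split. apply Rmult_le_pos; lra. rewrite <- (Rmult_1_r (/ eta y)). apply Rmult_le_compat; lra.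
Qed.

Lemma is_lim_jtp_coef (x : R) (n : Z) : 0 < x < 1 ->
  is_lim_seq (fun N => jtp_coef x N n) (/ eta (x ^ 2) * powerRZ x (n * n)).
Proof.
intros Hx. assert (Hy := sqr_unit x Hx). assert (E := eta_pos _ Hy).
apply is_lim_seq_mult'. 2: apply is_lim_seq_const.
replace (/ eta (x ^ 2)) with (eta (x ^ 2) * / eta (x ^ 2) * / eta (x ^ 2)) by (field; lra).
apply is_lim_seq_mult'. apply is_lim_seq_mult'.
- apply (is_lim_seq_subseq (eprod (x ^ 2)) _ (fun N => (2 * N)%nat)).
  apply eventually_subseq. intros; lia. apply is_lim_eprod, Hy.
- apply is_lim_qfact_inv; trivial. intros M. exists (M + Z.to_nat (- n))%nat. lia.
- apply is_lim_qfact_inv; trivial. intros M. exists (M + Z.to_nat n)%nat. lia.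
Qed.

Lemma ex_series_theta_half (z x : R) : 0 < x < 1 -> z <> 0 -> ex_series (fun n => Rabs (z ^ n * x ^
  (n * n))).
Proof.
intros Hx Hz. apply ex_series_DAlembert with 0. lra.
- intros n. apply Rmult_integral_contrapositive_currified; apply pow_nonzero; lra.
- apply is_lim_seq_ext with (fun n => (Rabs z * x) * (x ^ 2) ^ n).
  + intros n.
    replace (z ^ S n * x ^ (S n * S n) / (z ^ n * x ^ (n * n))) with (z * (x * (x ^ 2) ^ n)).
    * rewrite Rabs_mult, (Rabs_pos_eq (x * _)). ring.
      apply Rmult_le_pos. lra. apply pow_le. nra.
    * replace (S n * S n)%nat with (n * n + (2 * n + 1))%nat by lia.
      rewrite !pow_add, <- pow_mult. simpl. field. split; apply pow_nonzero; lra.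
  + replace (Finite 0) with (Finite (Rabs z * x * 0)) by (f_equal; ring).
    apply is_lim_seq_mult'. apply is_lim_seq_const. apply is_lim_seq_geom. rewrite Rabs_pos_eq; nra.
Qed.

Definition theta (z x : R) : R := bsum (fun n => powerRZ z n * powerRZ x (n * n)).

Lemma bsummable_theta (z x : R) : 0 < x < 1 -> z <> 0 ->
  bsummable (fun n => powerRZ z n * powerRZ x (n * n)).
Proof.
intros Hx Hz. split.
- eapply ex_series_ext, (ex_series_theta_half z x); trivial. intros n. cbv beta. f_equal.
  rewrite !pow_powerRZ. do 2 f_equal. lia.
- eapply ex_series_ext, (proj1 (ex_series_incr_1 (fun n => Rabs ((/ z) ^ n * x ^ (n * n))))),
  (ex_series_theta_half (/ z) x); trivial.
  2: apply Rinv_neq_0_compat, Hz.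
  intros n. cbv beta. f_equal. rewrite powerRZ_neg', <- powerRZ_inv', !pow_powerRZ. do 2 f_equal.
  lia.
Qed.

(** Even and odd parts of the partial triple product: it equals [E (z ^ 2) + z * O (z ^ 2)]. As
    functions of [w] they remain real at negative [w], which corresponds to imaginary [z]. *)
Definition jtp_even (x w : R) (N : nat) : R := bsum (fun m => jtp_coef x N (2 * m) * powerRZ w m).
Definition jtp_odd (x w : R) (N : nat) : R := bsum (fun m => jtp_coef x N (2 * m + 1) * powerRZ w
  m).

Lemma theta_term_even (x w : R) (m : Z) : 0 < x ->
  powerRZ x ((2 * m) * (2 * m)) * powerRZ w m = powerRZ w m * powerRZ (x ^ 4) (m * m).
Proof.
intros Hx. rewrite Rmult_comm. f_equal.
assert (E : powerRZ (x ^ 4) (m * m) = powerRZ x (4 * (m * m))).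
{ rewrite pow_powerRZ. rewrite !powerRZ_Rpower; trivial. rewrite Rpower_mult, <- mult_IZR. f_equal.
  apply powerRZ_lt, Hx. }
rewrite E. f_equal. ring.
Qed.

Lemma theta_term_odd (x w : R) (m : Z) : 0 < x ->
  powerRZ x ((2 * m + 1) * (2 * m + 1)) * powerRZ w m = x * (powerRZ (w * x ^ 4) m * powerRZ (x ^
    4) (m * m)).
Proof.
intros Hx. rewrite powerRZ_mult.
assert (E : forall k, powerRZ (x ^ 4) k = powerRZ x (4 * k)).
{ intros k. rewrite pow_powerRZ. rewrite !powerRZ_Rpower; trivial.
  rewrite Rpower_mult, <- mult_IZR. f_equal.
  apply powerRZ_lt, Hx. }
rewrite !E. replace ((2 * m + 1) * (2 * m + 1))%Z with (1 + 4 * m + 4 * (m * m))%Z by ring.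
rewrite !powerRZ_add, powerRZ_1 by lra. ring.
Qed.

Lemma pow4_unit (x : R) : 0 < x < 1 -> 0 < x ^ 4 < 1.
Proof. intros. apply (pow_unit x 3). trivial. Qed.

Lemma powerRZ_Rabs (w : R) (m : Z) : powerRZ (Rabs w) m = Rabs (powerRZ w m).
Proof.
destruct m; simpl; symmetry. apply Rabs_R1. symmetry. apply RPow_abs.
rewrite Rabs_inv. f_equal. symmetry. apply RPow_abs.
Qed.

Lemma bsummable_jtp_even (x w : R) (N : nat) : 0 < x < 1 -> w <> 0 ->
  bsummable (fun m => jtp_coef x N (2 * m) * powerRZ w m).
Proof.
intros Hx Hw.
apply bsummable_le with (fun m => / eta (x ^ 2) * (powerRZ (Rabs w) m * powerRZ (x ^ 4) (m * m))).
- intros m. rewrite <- theta_term_even by lra. rewrite Rabs_mult, <- powerRZ_Rabs, <- Rmult_assoc.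
  destruct (jtp_coef_bound x N (2 * m) Hx). rewrite (Rabs_pos_eq (jtp_coef _ _ _)) by trivial.
  apply Rmult_le_compat_r; trivial. rewrite powerRZ_Rabs. apply Rabs_pos.
- apply bsummable_scal, bsummable_theta. apply pow4_unit, Hx. apply Rabs_no_R0, Hw.
Qed.

Lemma bsummable_jtp_odd (x w : R) (N : nat) : 0 < x < 1 -> w <> 0 ->
  bsummable (fun m => jtp_coef x N (2 * m + 1) * powerRZ w m).
Proof.
intros Hx Hw.
apply bsummable_le with (fun m => / eta (x ^ 2) * (x * (powerRZ (Rabs w * x ^ 4) m * powerRZ (x ^
  4) (m * m)))).
- intros m. rewrite <- theta_term_odd by lra. rewrite Rabs_mult, <- powerRZ_Rabs, <- Rmult_assoc.
  destruct (jtp_coef_bound x N (2 * m + 1) Hx). rewrite (Rabs_pos_eq (jtp_coef _ _ _)) by trivial.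
  apply Rmult_le_compat_r; trivial. rewrite powerRZ_Rabs. apply Rabs_pos.
- apply bsummable_scal, bsummable_scal, bsummable_theta. apply pow4_unit, Hx.
  generalize (pow4_unit x Hx) (Rabs_no_R0 w Hw). intros.
  apply Rmult_integral_contrapositive_currified; lra.
Qed.

Lemma is_lim_jtp_even (x w : R) : 0 < x < 1 -> w <> 0 ->
  is_lim_seq (jtp_even x w) (/ eta (x ^ 2) * theta w (x ^ 4)).
Proof.
intros Hx Hw.
replace (/ eta (x ^ 2) * theta w (x ^ 4)) with (bsum (fun m => / eta (x ^ 2) * powerRZ x ((2 * m) *
  (2 * m)) * powerRZ w m)).
2: { unfold theta. rewrite <- bsum_scal. apply bsum_ext. intros m.
rewrite Rmult_assoc, theta_term_even by lra. trivial. }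
apply (bsum_dominated_lim _ _ (fun m => / eta (x ^ 2) * (powerRZ (Rabs w) m * powerRZ (x ^ 4) (m *
  m)))).
- apply bsummable_scal, bsummable_theta. apply pow4_unit, Hx. apply Rabs_no_R0, Hw.
- intros N m. rewrite <- theta_term_even by lra. rewrite Rabs_mult, <- powerRZ_Rabs, <- Rmult_assoc.
  destruct (jtp_coef_bound x N (2 * m) Hx). rewrite (Rabs_pos_eq (jtp_coef _ _ _)) by trivial.
  apply Rmult_le_compat_r; trivial. rewrite powerRZ_Rabs. apply Rabs_pos.
- intros m. apply is_lim_seq_mult'. apply is_lim_jtp_coef, Hx. apply is_lim_seq_const.
Qed.

Lemma is_lim_jtp_odd (x w : R) : 0 < x < 1 -> w <> 0 ->
  is_lim_seq (jtp_odd x w) (/ eta (x ^ 2) * (x * theta (w * x ^ 4) (x ^ 4))).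
Proof.
intros Hx Hw.
replace (/ eta (x ^ 2) * (x * theta (w * x ^ 4) (x ^ 4))) with (bsum (fun m => / eta (x ^ 2) *
  powerRZ x ((2 * m + 1) * (2 * m + 1)) * powerRZ w m)).
2: { unfold theta. rewrite <- !bsum_scal. apply bsum_ext. intros m.
rewrite Rmult_assoc, theta_term_odd by lra. trivial. }
apply (bsum_dominated_lim _ _ (fun m => / eta (x ^ 2) * (x * (powerRZ (Rabs w * x ^ 4) m * powerRZ
  (x ^ 4) (m * m))))).
- apply bsummable_scal, bsummable_scal, bsummable_theta. apply pow4_unit, Hx.
  generalize (pow4_unit x Hx) (Rabs_no_R0 w Hw). intros.
  apply Rmult_integral_contrapositive_currified; lra.
- intros N m. rewrite <- theta_term_odd by lra. rewrite Rabs_mult, <- powerRZ_Rabs, <- Rmult_assoc.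
  destruct (jtp_coef_bound x N (2 * m + 1) Hx). rewrite (Rabs_pos_eq (jtp_coef _ _ _)) by trivial.
  apply Rmult_le_compat_r; trivial. rewrite powerRZ_Rabs. apply Rabs_pos.
- intros m. apply is_lim_seq_mult'. apply is_lim_jtp_coef, Hx. apply is_lim_seq_const.
Qed.

(** The middle term of the next factor exchanges the parts: [(z + 1 / z) * z = 1 + w] here, and
    [z + 1 / z = z (1 + 1 / w)] in [jtp_odd_S]. *)
Lemma jtp_even_S (x w : R) (N : nat) : 0 < x < 1 -> w <> 0 ->
  jtp_even x w (S N) = (1 + x ^ (4 * N + 2)) * jtp_even x w N + x ^ (2 * N + 1) * (1 + w) * jtp_odd
    x w N.
Proof.
intros Hx Hw. unfold jtp_even, jtp_odd.
assert (HE := bsummable_jtp_even x w N Hx Hw). assert (HO := bsummable_jtp_odd x w N Hx Hw).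
destruct (bsum_shift_pred _ HO) as [HS SH].
set (c := x ^ (2 * N + 1)).
transitivity (bsum (fun m => (1 + x ^ (4 * N + 2)) * (jtp_coef x N (2 * m) * powerRZ w m)
  + (c * (jtp_coef x N (2 * m + 1) * powerRZ w m)
    + (c * w) * (jtp_coef x N (2 * (m - 1) + 1) * powerRZ w (m - 1))))).
- apply bsum_ext. intros m. rewrite jtp_coef_S by trivial. fold c.
  replace (2 * (m - 1) + 1)%Z with (2 * m - 1)%Z by ring.
  replace (powerRZ w m) with (powerRZ w (m - 1) * w). ring.
  rewrite <- (powerRZ_1 w) at 2. rewrite <- powerRZ_add by trivial. f_equal. lia.
- rewrite !bsum_plus, !bsum_scal, SH. ring.
  all: repeat apply bsummable_plus; apply bsummable_scal; trivial.
Qed.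

Lemma jtp_odd_S (x w : R) (N : nat) : 0 < x < 1 -> w <> 0 ->
  jtp_odd x w (S N) = (1 + x ^ (4 * N + 2)) * jtp_odd x w N + x ^ (2 * N + 1) * (1 + / w) *
    jtp_even x w N.
Proof.
intros Hx Hw. unfold jtp_even, jtp_odd.
assert (HE := bsummable_jtp_even x w N Hx Hw). assert (HO := bsummable_jtp_odd x w N Hx Hw).
destruct (bsum_shift _ HE) as [HS SH].
set (c := x ^ (2 * N + 1)).
transitivity (bsum (fun m => (1 + x ^ (4 * N + 2)) * (jtp_coef x N (2 * m + 1) * powerRZ w m)
  + (c * (jtp_coef x N (2 * m) * powerRZ w m)
    + (c * / w) * (jtp_coef x N (2 * (m + 1)) * powerRZ w (m + 1))))).
- apply bsum_ext. intros m. rewrite jtp_coef_S by trivial. fold c.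
  replace (2 * (m + 1))%Z with (2 * m + 1 + 1)%Z by ring.
  replace (2 * m + 1 - 1)%Z with (2 * m)%Z by ring.
  rewrite powerRZ_add, powerRZ_1 by trivial. field. trivial.
- rewrite !bsum_plus, !bsum_scal, SH. ring.
  all: repeat apply bsummable_plus; apply bsummable_scal; trivial.
Qed.

Lemma Series_zero (a : nat -> R) : (forall n, a n = 0) -> Series a = 0.
Proof.
intros H. rewrite (Series_ext a (fun n => 0 * a n)), Series_scal_l. ring.
intros n. rewrite H. ring.
Qed.

Lemma jtp_even_0 (x w : R) : jtp_even x w 0 = 1.
Proof.
unfold jtp_even, bsum.
rewrite (Series_incr_1 (fun n => jtp_coef x 0 (2 * Z.of_nat n) * powerRZ w (Z.of_nat n))).
- rewrite !Series_zero.
  + rewrite jtp_coef_0. simpl. ring.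
  + intros n. rewrite jtp_coef_0. destruct (Z.eqb_spec (2 * - Z.of_nat (S n)) 0). lia. ring.
  + intros n. rewrite jtp_coef_0. destruct (Z.eqb_spec (2 * Z.of_nat (S n)) 0). lia. ring.
- apply ex_series_incr_1. exists 0.
  apply (is_series_ext (fun _ => 0)).
  + intros n. rewrite jtp_coef_0. destruct (Z.eqb_spec (2 * Z.of_nat (S n)) 0). lia.
    symmetry; apply Rmult_0_l.
  + change (is_lim_seq (sum_n (fun _ => 0)) 0). apply (is_lim_seq_ext (fun _ => 0)). intros n.
    rewrite sum_n_const. symmetry; apply Rmult_0_r. apply is_lim_seq_const.
Qed.

Lemma jtp_odd_0 (x w : R) : jtp_odd x w 0 = 0.
Proof.
unfold jtp_odd, bsum. rewrite !Series_zero. ring.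
- intros n. rewrite jtp_coef_0. destruct (Z.eqb_spec (2 * - Z.of_nat (S n) + 1) 0). lia. ring.
- intros n. rewrite jtp_coef_0. destruct (Z.eqb_spec (2 * Z.of_nat n + 1) 0). lia. ring.
Qed.

Lemma jtp_finite (x z : R) (N : nat) : 0 < x < 1 -> z <> 0 ->
  jtp_even x (z ^ 2) N + z * jtp_odd x (z ^ 2) N =
  pprod (fun n => (1 + z * x ^ (2 * n + 1)) * (1 + / z * x ^ (2 * n + 1))) N.
Proof.
intros Hx Hz. assert (z ^ 2 <> 0) by (apply pow_nonzero, Hz).
induction N as [|N IH].
- rewrite jtp_even_0, jtp_odd_0. simpl. ring.
- cbn [pprod]. rewrite <- IH, jtp_even_S, jtp_odd_S by trivial.
  replace (4 * N + 2)%nat with (2 * N + 1 + (2 * N + 1))%nat by lia. rewrite pow_add. field.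
  trivial.
Qed.

(** For [w = z ^ 2] the left side is the partial product at [z] times the one at [- z]. The
    induction only uses the recurrences of both parts, so negative [w] are covered. *)
Lemma jtp_finite_norm (x w : R) (N : nat) : 0 < x < 1 -> w <> 0 ->
  jtp_even x w N ^ 2 - w * jtp_odd x w N ^ 2 =
  pprod (fun n => (1 - w * x ^ (4 * n + 2)) * (1 - / w * x ^ (4 * n + 2))) N.
Proof.
intros Hx Hw. induction N as [|N IH].
- rewrite jtp_even_0, jtp_odd_0. simpl. ring.
- cbn [pprod]. rewrite <- IH, jtp_even_S, jtp_odd_S by trivial.
  replace (4 * N + 2)%nat with (2 * N + 1 + (2 * N + 1))%nat by lia. rewrite pow_add. field.
  trivial.
Qed.

Lemma theta_even_odd (x z : R) : 0 < x < 1 -> z <> 0 ->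
  theta z x = theta (z ^ 2) (x ^ 4) + z * (x * theta (z ^ 2 * x ^ 4) (x ^ 4)).
Proof.
intros Hx Hz.
destruct (bsum_even_odd _ (bsummable_theta z x Hx Hz)) as [_ E]. unfold theta.
rewrite E, <- !bsum_scal.
assert (P : forall n, powerRZ z (2 * n) = powerRZ (z ^ 2) n).
{ intros n. replace (2 * n)%Z with (n + n)%Z by ring. rewrite powerRZ_add by trivial.
  rewrite <- powerRZ_mult. f_equal. ring. }
f_equal; apply bsum_ext; intros n.
- rewrite P, Rmult_comm, theta_term_even by lra. trivial.
- rewrite <- theta_term_odd, powerRZ_add, P, powerRZ_1 by (trivial; lra). ring.
Qed.

Lemma jacobi_triple_product (x z : R) : 0 < x < 1 -> z <> 0 ->
  is_lim_seq (pprod (fun n => (1 + z * x ^ (2 * n + 1)) * (1 + / z * x ^ (2 * n + 1))))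
    (theta z x / eta (x ^ 2)).
Proof.
intros Hx Hz. assert (z ^ 2 <> 0) by (apply pow_nonzero, Hz).
apply (is_lim_seq_ext _ _ _ (fun N => jtp_finite x z N Hx Hz)).
replace (theta z x / eta (x ^ 2)) with
  (/ eta (x ^ 2) * theta (z ^ 2) (x ^ 4) + z * (/ eta (x ^ 2) * (x * theta (z ^ 2 * x ^ 4) (x ^
    4)))).
- apply is_lim_seq_plus'. apply is_lim_jtp_even; trivial.
  apply is_lim_seq_mult'. apply is_lim_seq_const. apply is_lim_jtp_odd; trivial.
- rewrite (theta_even_odd x z) by trivial. generalize (eta_pos _ (sqr_unit x Hx)). intros. field.
  lra.
Qed.

(* For [w = - u ^ 2] this is the squared modulus of the triple product at [z = i u]. *)
Lemma jacobi_triple_product_norm (x w : R) : 0 < x < 1 -> w <> 0 ->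
  is_lim_seq (pprod (fun n => (1 - w * x ^ (4 * n + 2)) * (1 - / w * x ^ (4 * n + 2))))
    ((theta w (x ^ 4) ^ 2 - w * x ^ 2 * theta (w * x ^ 4) (x ^ 4) ^ 2) / eta (x ^ 2) ^ 2).
Proof.
intros Hx Hw. assert (He := eta_pos _ (sqr_unit x Hx)).
apply (is_lim_seq_ext _ _ _ (fun N => jtp_finite_norm x w N Hx Hw)).
set (E := / eta (x ^ 2) * theta w (x ^ 4)).
set (O := / eta (x ^ 2) * (x * theta (w * x ^ 4) (x ^ 4))).
replace ((theta w (x ^ 4) ^ 2 - w * x ^ 2 * theta (w * x ^ 4) (x ^ 4) ^ 2) / eta (x ^ 2) ^ 2)
  with (E * (E * 1) - w * (O * (O * 1))) by (unfold E, O; field; lra).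
assert (LE := is_lim_jtp_even x w Hx Hw). assert (LO := is_lim_jtp_odd x w Hx Hw).
apply is_lim_seq_minus'; [|apply is_lim_seq_mult'; [apply is_lim_seq_const|]];
repeat apply is_lim_seq_mult'; trivial; apply is_lim_seq_const.
Qed.

(** * Theta functions as eta quotients *)

(** Ramanujan's theta functions: [phi x] is the sum of [x ^ (n ^ 2)] over the integers, [phi_neg x]
    the same series at [- x], and [psi x] the sum of [x ^ (n (n + 1) / 2)] over [n >= 0]. As eta
    quotients their multiplicative relations reduce to [field]; the triple product connects them
    with the series. *)
Definition phi (x : R) : R := eta (x ^ 2) ^ 5 / (eta x ^ 2 * eta (x ^ 4) ^ 2).
Definition phi_neg (x : R) : R := eta x ^ 2 / eta (x ^ 2).
Definition psi (x : R) : R := eta (x ^ 2) ^ 2 / eta x.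

Lemma phi_pow (x : R) (n : nat) :
  phi (x ^ n) = eta (x ^ (n * 2)) ^ 5 / (eta (x ^ n) ^ 2 * eta (x ^ (n * 4)) ^ 2).
Proof. unfold phi. rewrite <- !pow_mult. reflexivity. Qed.

Lemma phi_neg_pow (x : R) (n : nat) : phi_neg (x ^ n) = eta (x ^ n) ^ 2 / eta (x ^ (n * 2)).
Proof. unfold phi_neg. rewrite <- !pow_mult. reflexivity. Qed.

Lemma psi_pow (x : R) (n : nat) : psi (x ^ n) = eta (x ^ (n * 2)) ^ 2 / eta (x ^ n).
Proof. unfold psi. rewrite <- !pow_mult. reflexivity. Qed.

Lemma eta_pow_pos (x : R) (n : nat) : 0 < x < 1 -> 0 < eta (x ^ S n).
Proof. intros Hx. apply eta_pos, pow_unit, Hx. Qed.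

(** Products over odd indices and products with plus signs are complementary factors of Euler
    products, and their limits are obtained by division. *)
Lemma is_lim_seq_cofactor (u v w : nat -> R) (a c : R) :
  (forall n, u n * v n = w n) -> (forall n, u n <> 0) -> a <> 0 ->
  is_lim_seq u a -> is_lim_seq w c -> is_lim_seq v (c / a).
Proof.
intros E U A Lu Lw. apply is_lim_seq_ext with (fun n => w n / u n).
intros n. rewrite <- E. field. apply U. apply is_lim_seq_div'; trivial.
Qed.

Lemma is_lim_seq_double (u : nat -> R) (l : R) :
  is_lim_seq u l -> is_lim_seq (fun N => u (2 * N)%nat) l.
Proof. intros H. apply (is_lim_seq_subseq u _ (fun N => (2 * N)%nat)); trivial.
apply eventually_subseq. intros; lia. Qed.

Lemma is_lim_one_minus_odd (x : R) : 0 < x < 1 ->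
  is_lim_seq (pprod (fun n => 1 - x ^ (2 * n + 1))) (eta x / eta (x ^ 2)).
Proof.
intros Hx. assert (Hy := sqr_unit x Hx).
apply (is_lim_seq_cofactor (eprod (x ^ 2)) _ (fun N => eprod x (2 * N))).
- intros N. unfold eprod. rewrite pprod_even_odd, Rmult_comm. f_equal; apply pprod_ext; intros n.
  + do 2 f_equal. lia.
  + rewrite <- pow_mult. do 2 f_equal. lia.
- intros N. generalize (eprod_pos _ N Hy). lra.
- generalize (eta_pos _ Hy). lra.
- apply is_lim_eprod, Hy.
- apply is_lim_seq_double, is_lim_eprod, Hx.
Qed.

Lemma is_lim_one_plus (x : R) : 0 < x < 1 ->
  is_lim_seq (pprod (fun n => 1 + x ^ S n)) (eta (x ^ 2) / eta x).
Proof.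
intros Hx. assert (Hy := sqr_unit x Hx).
apply (is_lim_seq_cofactor (eprod x) _ (eprod (x ^ 2))).
- intros N. unfold eprod. rewrite <- pprod_mult. apply pprod_ext. intros n.
  rewrite <- pow_mult. replace (2 * S n)%nat with (S n + S n)%nat by lia. rewrite pow_add. ring.
- intros N. generalize (eprod_pos _ N Hx). lra.
- generalize (eta_pos _ Hx). lra.
- apply is_lim_eprod, Hx.
- apply is_lim_eprod, Hy.
Qed.

Lemma is_lim_one_plus_odd (x : R) : 0 < x < 1 ->
  is_lim_seq (pprod (fun n => 1 + x ^ (2 * n + 1))) (eta (x ^ 2) ^ 2 / (eta x * eta (x ^ 4))).
Proof.
intros Hx. assert (Hy := sqr_unit x Hx).
assert (E1 := eta_pos x Hx). assert (E2 := eta_pow_pos x 1 Hx). assert (E4 := eta_pow_pos x 3 Hx).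
replace (eta (x ^ 2) ^ 2 / (eta x * eta (x ^ 4))) with (eta (x ^ 2) / eta ((x ^ 2) ^ 2) / (eta x /
  eta (x ^ 2))).
2: { rewrite <- pow_mult. change (2 * 2)%nat with 4%nat. field. lra. }
apply (is_lim_seq_cofactor (pprod (fun n => 1 - x ^ (2 * n + 1))) _ (pprod (fun n => 1 - (x ^ 2) ^
  (2 * n + 1)))).
- intros N. rewrite <- pprod_mult. apply pprod_ext. intros n.
  rewrite <- pow_mult. replace (2 * (2 * n + 1))%nat with (2 * n + 1 + (2 * n + 1))%nat by lia.
  rewrite (pow_add x (2 * n + 1)). ring.
- intros N. apply Rgt_not_eq, pprod_pos. intros n. replace (2 * n + 1)%nat with (S (2 * n)) by lia.
  generalize (pow_unit x (2 * n) Hx). lra.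
- apply Rgt_not_eq, Rdiv_lt_0_compat; trivial.
- apply is_lim_one_minus_odd, Hx.
- apply is_lim_one_minus_odd, Hy.
Qed.

Lemma theta_of_product (x z l : R) : 0 < x < 1 -> z <> 0 ->
  is_lim_seq (pprod (fun n => (1 + z * x ^ (2 * n + 1)) * (1 + / z * x ^ (2 * n + 1)))) l ->
  theta z x = eta (x ^ 2) * l.
Proof.
intros Hx Hz L. assert (J := jacobi_triple_product x z Hx Hz).
apply is_lim_seq_unique in L. apply is_lim_seq_unique in J. rewrite J in L.
apply (proj1 (Rbar_finite_eq _ _)) in L. rewrite <- L.
field. generalize (eta_pow_pos x 1 Hx). lra.
Qed.

Lemma theta_phi (x : R) : 0 < x < 1 -> theta 1 x = phi x.
Proof.
intros Hx. assert (E1 := eta_pos x Hx). assert (E2 := eta_pow_pos x 1 Hx).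
assert (E4 := eta_pow_pos x 3 Hx).
rewrite (theta_of_product x 1 (eta (x ^ 2) ^ 2 / (eta x * eta (x ^ 4)) * (eta (x ^ 2) ^ 2 / (eta x
  * eta (x ^ 4))))); trivial; try lra.
- unfold phi. field. lra.
- apply is_lim_seq_ext with (fun N => pprod (fun n => 1 + x ^ (2 * n + 1)) N * pprod (fun n => 1 +
  x ^ (2 * n + 1)) N).
  + intros N. rewrite <- pprod_mult. apply pprod_ext. intros n. rewrite Rinv_1. ring.
  + apply is_lim_seq_mult'; apply is_lim_one_plus_odd, Hx.
Qed.

Lemma theta_phi_neg (x : R) : 0 < x < 1 -> theta (-1) x = phi_neg x.
Proof.
intros Hx. assert (E1 := eta_pos x Hx). assert (E2 := eta_pow_pos x 1 Hx).
rewrite (theta_of_product x (-1) (eta x / eta (x ^ 2) * (eta x / eta (x ^ 2)))); trivial; try lra.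
- unfold phi_neg. field. lra.
- apply is_lim_seq_ext with (fun N => pprod (fun n => 1 - x ^ (2 * n + 1)) N * pprod (fun n => 1 -
  x ^ (2 * n + 1)) N).
  + intros N. rewrite <- pprod_mult. apply pprod_ext. intros n. field.
  + apply is_lim_seq_mult'; apply is_lim_one_minus_odd, Hx.
Qed.

Lemma theta_psi (x : R) : 0 < x < 1 -> theta x x = 2 * psi (x ^ 2).
Proof.
intros Hx. assert (Hy := sqr_unit x Hx). assert (E2 := eta_pow_pos x 1 Hx).
set (l := eta ((x ^ 2) ^ 2) / eta (x ^ 2)).
rewrite (theta_of_product x x (l * (2 * l))); trivial; try lra.
- unfold psi, l. field. lra.
- assert (L := is_lim_one_plus _ Hy). fold l in L.
  apply is_lim_seq_ext with (fun N => pprod (fun n => 1 + (x ^ 2) ^ S n) N * pprod (fun n => 1 + (x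
    ^ 2) ^ n) N).
  + intros N. rewrite <- pprod_mult. apply pprod_ext. intros n. rewrite <- !pow_mult.
    replace (2 * S n)%nat with (S (2 * n + 1)) by lia. rewrite Nat.add_1_r. simpl pow. field. lra.
  + apply is_lim_seq_mult'; trivial.
    (* The factor of index 0 is [1 + 1], the source of the 2 in the statement. *)
    apply is_lim_seq_incr_1.
    apply is_lim_seq_ext with (fun N => 2 * pprod (fun n => 1 + (x ^ 2) ^ S n) N).
    * intros N. rewrite pprod_incr_1. rewrite pow_O. ring.
    * apply is_lim_seq_mult'; trivial. apply is_lim_seq_const.
Qed.

Lemma phi_pos (x : R) : 0 < x < 1 -> 0 < phi x.
Proof.
intros Hx. apply Rdiv_lt_0_compat.
- apply pow_lt, (eta_pow_pos x 1), Hx.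
- apply Rmult_lt_0_compat; apply pow_lt. apply eta_pos, Hx. apply (eta_pow_pos x 3), Hx.
Qed.

Lemma phi_neg_pos (x : R) : 0 < x < 1 -> 0 < phi_neg x.
Proof.
intros Hx. apply Rdiv_lt_0_compat. apply pow_lt, eta_pos, Hx. apply (eta_pow_pos x 1), Hx.
Qed.

Lemma psi_pos (x : R) : 0 < x < 1 -> 0 < psi x.
Proof.
intros Hx. apply Rdiv_lt_0_compat. apply pow_lt, (eta_pow_pos x 1), Hx. apply eta_pos, Hx.
Qed.

(** Separates the even squares from the odd ones [1 + 4 m + 4 m ^ 2] in the theta series at
    [z = 1]. *)
Lemma phi_dissection (x : R) : 0 < x < 1 -> phi x = phi (x ^ 4) + 2 * x * psi (x ^ 8).
Proof.
intros Hx. assert (H4 := pow4_unit x Hx).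
rewrite <- theta_phi, theta_even_odd by (trivial; lra).
replace (1 ^ 2) with 1 by ring. rewrite !Rmult_1_l, theta_phi, theta_psi by trivial.
rewrite <- pow_mult. change (4 * 2)%nat with 8%nat. ring.
Qed.

Lemma phi_neg_dissection (x : R) : 0 < x < 1 -> phi_neg x = phi (x ^ 4) - 2 * x * psi (x ^ 8).
Proof.
intros Hx. assert (H4 := pow4_unit x Hx).
rewrite <- theta_phi_neg, theta_even_odd by (trivial; lra).
replace ((-1) ^ 2) with 1 by ring. rewrite !Rmult_1_l, theta_phi, theta_psi by trivial.
rewrite <- pow_mult. change (4 * 2)%nat with 8%nat. ring.
Qed.

Lemma psi_sqr (x : R) : 0 < x < 1 -> psi x ^ 2 = phi x * psi (x ^ 2).
Proof.
intros Hx. assert (E1 := eta_pos x Hx). assert (E2 := eta_pow_pos x 1 Hx).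
assert (E4 := eta_pow_pos x 3 Hx).
rewrite psi_pow. unfold phi, psi. change (2 * 2)%nat with 4%nat. field. lra.
Qed.

Lemma phi_mul_phi_neg (x : R) : 0 < x < 1 -> phi x * phi_neg x = phi_neg (x ^ 2) ^ 2.
Proof.
intros Hx. assert (E1 := eta_pos x Hx). assert (E2 := eta_pow_pos x 1 Hx).
assert (E4 := eta_pow_pos x 3 Hx).
rewrite phi_neg_pow. unfold phi, phi_neg. change (2 * 2)%nat with 4%nat. field. lra.
Qed.

(** At [x = sqrt p] the product of the two dissections is a difference of squares, while
    [phi x * phi_neg x = phi_neg p ^ 2]. *)
Lemma phi_neg_sqr (p : R) : 0 < p < 1 -> phi_neg p ^ 2 = phi (p ^ 2) ^ 2 - 4 * p * psi (p ^ 4) ^ 2.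
Proof.
intros Hp. set (x := sqrt p).
assert (S : x ^ 2 = p) by (apply pow2_sqrt; lra).
assert (Hx : 0 < x < 1).
{ split. apply sqrt_lt_R0; lra. rewrite <- sqrt_1. apply sqrt_lt_1; lra. }
rewrite <- S, <- phi_mul_phi_neg, phi_dissection, phi_neg_dissection by trivial.
rewrite <- !pow_mult. cbn [Nat.mul Nat.add]. ring.
Qed.

(** The dissections give [phi p ^ 2 - phi_neg p ^ 2 = 8 p phi (p ^ 4) psi (p ^ 8)], and [psi_sqr]
    makes this [8 p psi (p ^ 4) ^ 2]. *)
Lemma phi_sqr (p : R) : 0 < p < 1 -> phi p ^ 2 = phi (p ^ 2) ^ 2 + 4 * p * psi (p ^ 4) ^ 2.
Proof.
intros Hp. assert (H4 := pow4_unit p Hp).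
assert (E := phi_neg_sqr p Hp). assert (F := psi_sqr (p ^ 4) H4).
rewrite <- pow_mult in F. cbn [Nat.mul Nat.add] in F.
rewrite phi_neg_dissection in E by trivial. rewrite phi_dissection by trivial.
replace (phi (p ^ 2) ^ 2) with ((phi (p ^ 4) - 2 * p * psi (p ^ 8)) ^ 2 + 4 * p * psi (p ^ 4) ^ 2)
  by lra.
rewrite F. ring.
Qed.

(** * The theta modulus and its identification with the singular modulus *)

(* [theta_2 (q) ^ 2 / theta_3 (q) ^ 2] *)
Definition theta_modulus (q : R) : R := 4 * sqrt q * psi (q ^ 2) ^ 2 / phi q ^ 2.

Lemma sqrt_unit (q : R) : 0 < q < 1 -> 0 < sqrt q < 1.
Proof. intros H. split. apply sqrt_lt_R0; lra. rewrite <- sqrt_1. apply sqrt_lt_1; lra. Qed.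

Lemma theta_modulus_sqr (p : R) : 0 < p < 1 ->
  theta_modulus (p ^ 2) = 4 * p * psi (p ^ 4) ^ 2 / phi (p ^ 2) ^ 2.
Proof.
intros Hp. unfold theta_modulus. rewrite sqrt_pow2 by lra. rewrite <- pow_mult. reflexivity.
Qed.

Lemma one_plus_theta_modulus (p : R) : 0 < p < 1 ->
  1 + theta_modulus (p ^ 2) = phi p ^ 2 / phi (p ^ 2) ^ 2.
Proof.
intros Hp. rewrite theta_modulus_sqr, (phi_sqr p) by trivial.
field. apply Rgt_not_eq, phi_pos, sqr_unit, Hp.
Qed.

Lemma one_minus_theta_modulus (p : R) : 0 < p < 1 ->
  1 - theta_modulus (p ^ 2) = phi_neg p ^ 2 / phi (p ^ 2) ^ 2.
Proof.
intros Hp. rewrite theta_modulus_sqr, phi_neg_sqr by trivial.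
field. apply Rgt_not_eq, phi_pos, sqr_unit, Hp.
Qed.

Lemma theta_modulus_bounds (q : R) : 0 < q < 1 -> 0 < theta_modulus q < 1.
Proof.
intros Hq. assert (Hp := sqrt_unit q Hq). split.
- apply Rdiv_lt_0_compat. 2: apply pow_lt, phi_pos, Hq.
  apply Rmult_lt_0_compat. lra. apply pow_lt, psi_pos, sqr_unit, Hq.
- assert (E := one_minus_theta_modulus _ Hp). rewrite pow2_sqrt in E by lra.
  assert (0 < phi_neg (sqrt q) ^ 2 / phi q ^ 2). 2: lra.
  apply Rdiv_lt_0_compat; apply pow_lt. apply phi_neg_pos, Hp. apply phi_pos, Hq.
Qed.

Lemma theta_modulus_landen (q : R) : 0 < q < 1 ->
  theta_modulus q ^ 2 = landen (theta_modulus (q ^ 2)).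
Proof.
intros Hq. assert (Hq2 := sqr_unit q Hq).
unfold landen. rewrite one_plus_theta_modulus, theta_modulus_sqr by trivial.
unfold theta_modulus.
assert (E := psi_sqr (q ^ 2) Hq2). rewrite <- pow_mult in E. cbn [Nat.mul Nat.add] in E. rewrite E.
assert (S : sqrt q ^ 2 = q) by (apply pow2_sqrt; lra).
assert (F1 := phi_pos q Hq). assert (F2 := phi_pos _ Hq2).
transitivity (16 * sqrt q ^ 2 * (phi (q ^ 2) * psi (q ^ 4)) ^ 2 / phi q ^ 4).
field. lra. rewrite S. field. lra.
Qed.

(** The quotient is [4 eta (y ^ 4) ^ 8 eta y ^ 4 / eta (y ^ 2) ^ 12], and all these eta values lie
    between [eta q] and 1. The Landen iteration, with [y = q ^ (2 ^ n)], needs bounds independent of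
    [y]. *)
Lemma theta_modulus_div_sqrt (q y : R) : 0 < q < 1 -> 0 < y <= q ->
  eta q ^ 12 / 4 <= theta_modulus y / sqrt y <= 4 / eta q ^ 12.
Proof.
intros Hq Hy. set (e := eta q).
assert (He : 0 < e) by apply eta_pos, Hq. assert (He1 : e <= 1) by apply eta_le_1, Hq.
assert (B : forall n, e <= eta (y ^ S n) <= 1).
{ intros n. assert (P := pow_unit y n ltac:(lra)). split.
  - apply eta_antitone; try lra. split. lra. simpl.
    generalize (pow_incr y 1 n ltac:(lra)). rewrite pow1. nra.
  - apply eta_le_1, P. }
assert (B1 := B 0%nat). rewrite pow_1 in B1. assert (B2 := B 1%nat). assert (B4 := B 3%nat).
set (e1 := eta y) in *. set (e2 := eta (y ^ 2)) in *. set (e4 := eta (y ^ 4)) in *.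
replace (theta_modulus y / sqrt y) with (4 * (e4 ^ 8 * e1 ^ 4) / e2 ^ 12).
2: { unfold theta_modulus. rewrite psi_pow. unfold phi. change (2 * 2)%nat with 4%nat.
fold e1 e2 e4.
     field. assert (0 < sqrt y) by (apply sqrt_lt_R0; lra). repeat split; lra. }
assert (P12 : 0 < e ^ 12) by (apply pow_lt, He).
assert (Q12 : 0 < e2 ^ 12) by (apply pow_lt; lra).
assert (L2 : e ^ 12 <= e2 ^ 12 <= 1).
{ split. apply pow_incr; lra. rewrite <- (pow1 12). apply pow_incr; lra. }
assert (L4 : e ^ 8 <= e4 ^ 8 <= 1).
{ split. apply pow_incr; lra. rewrite <- (pow1 8). apply pow_incr; lra. }
assert (L1 : e ^ 4 <= e1 ^ 4 <= 1).
{ split. apply pow_incr; lra. rewrite <- (pow1 4). apply pow_incr; lra. }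
assert (P8 : 0 < e ^ 8) by (apply pow_lt, He). assert (P4 : 0 < e ^ 4) by (apply pow_lt, He).
assert (M : e ^ 12 <= e4 ^ 8 * e1 ^ 4 <= 1).
{ split. replace (e ^ 12) with (e ^ 8 * e ^ 4) by ring. apply Rmult_le_compat; lra.
  rewrite <- (Rmult_1_r 1). apply Rmult_le_compat; lra. }
split.
- apply (proj1 (Rle_div_r (e ^ 12 / 4) _ _ Q12)). nra.
- assert (0 < / e2 ^ 12) by (apply Rinv_0_lt_compat; trivial).
  assert (/ e2 ^ 12 <= / e ^ 12) by (apply Rinv_le_contravar; lra).
  unfold Rdiv. apply Rmult_le_compat; lra.
Qed.

Lemma singular_modulus_theta (r : R) : 0 < r ->
  singular_modulus r = theta_modulus (exp (- PI * sqrt r)).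
Proof.
intros Hr. generalize PI_RGT_0; intros HP. set (q := exp (- PI * sqrt r)).
assert (Hs := sqrt_lt_R0 r Hr).
assert (Hq : 0 < q < 1).
{ split. apply exp_pos. rewrite <- exp_0. apply exp_increasing. nra. }
apply singular_modulus_unique. apply theta_modulus_bounds, Hq.
assert (P : forall n, 0 < q ^ (2 ^ n) <= q).
{ intros n. split. apply pow_lt; lra.
  replace (2 ^ n)%nat with (S (Init.Nat.pred (2 ^ n))) by (generalize (Nat.pow_nonzero 2 n); lia).
  simpl. generalize (pow_incr q 1 (Init.Nat.pred (2 ^ n)) ltac:(lra)). rewrite pow1. nra. }
assert (He0 := eta_pos q Hq). assert (He : 0 < eta q ^ 12) by apply pow_lt, He0.
rewrite <- (pow_1 q). change 1%nat with (2 ^ 0)%nat.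
rewrite (period_ratio_limit (fun n => theta_modulus (q ^ (2 ^ n))) q (4 / eta q ^ 12)); trivial.
- unfold q. rewrite ln_exp. field. lra.
- apply Rdiv_lt_0_compat; lra.
- intros n. apply theta_modulus_bounds. specialize (P n). lra.
- intros n. specialize (P n). rewrite theta_modulus_landen by lra. rewrite <- pow_mult.
  do 3 f_equal. simpl. lia.
- intros n. replace (/ (4 / eta q ^ 12)) with (eta q ^ 12 / 4) by (field; lra).
  apply theta_modulus_div_sqrt; trivial.
Qed.

(** * The products modulo 8 *)

(* The products of [1 - p ^ n] over [n = 1, 7] and over [n = 3, 5] modulo 8, times [eta (p ^ 8)]. *)
Definition theta17 (p : R) : R := theta (- p ^ 3) (p ^ 4).
Definition theta35 (p : R) : R := theta (- / p) (p ^ 4).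

Lemma is_lim_theta17 (p : R) : 0 < p < 1 ->
  is_lim_seq (pprod (fun n => (1 - p ^ (8 * n + 1)) * (1 - p ^ (8 * n + 7)))) (theta17 p / eta (p ^
    8)).
Proof.
intros Hp. assert (H3 := pow_unit p 2 Hp).
assert (J := jacobi_triple_product (p ^ 4) (- p ^ 3) (pow4_unit p Hp) ltac:(lra)).
rewrite <- pow_mult in J. change (4 * 2)%nat with 8%nat in J.
apply is_lim_seq_ext with (2 := J). intros N. apply pprod_ext. intros n. rewrite <- pow_mult.
replace (4 * (2 * n + 1))%nat with (3 + (8 * n + 1))%nat by lia.
replace (8 * n + 7)%nat with (3 + (3 + (8 * n + 1)))%nat by lia.
rewrite !(pow_add p 3). field. lra.
Qed.

Lemma is_lim_theta35 (p : R) : 0 < p < 1 ->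
  is_lim_seq (pprod (fun n => (1 - p ^ (8 * n + 3)) * (1 - p ^ (8 * n + 5)))) (theta35 p / eta (p ^
    8)).
Proof.
intros Hp. assert (Hi : 0 < / p) by (apply Rinv_0_lt_compat; lra).
assert (J := jacobi_triple_product (p ^ 4) (- / p) (pow4_unit p Hp) ltac:(lra)).
rewrite <- pow_mult in J. change (4 * 2)%nat with 8%nat in J.
apply is_lim_seq_ext with (2 := J). intros N. apply pprod_ext. intros n. rewrite <- pow_mult.
replace (4 * (2 * n + 1))%nat with (S (8 * n + 3)) by lia.
replace (8 * n + 5)%nat with (S (S (8 * n + 3))) by lia.
simpl pow. field. lra.
Qed.

(** The residues 1, 3, 5, 7 modulo 8 exhaust the odd numbers. *)
Lemma theta17_mul_theta35 (p : R) : 0 < p < 1 ->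
  theta17 p * theta35 p = eta (p ^ 8) ^ 2 * (eta p / eta (p ^ 2)).
Proof.
intros Hp. assert (E8 := eta_pow_pos p 7 Hp). assert (E2 := eta_pow_pos p 1 Hp).
assert (L := is_lim_seq_mult' _ _ _ _ (is_lim_theta17 p Hp) (is_lim_theta35 p Hp)).
assert (M := is_lim_seq_double _ _ (is_lim_seq_double _ _ (is_lim_one_minus_odd p Hp))).
assert (E : theta17 p / eta (p ^ 8) * (theta35 p / eta (p ^ 8)) = eta p / eta (p ^ 2)).
{ apply Rbar_finite_eq. rewrite <- (is_lim_seq_unique _ _ L), <- (is_lim_seq_unique _ _ M).
  apply Lim_seq_ext. intros N. rewrite !pprod_even_odd, <- !pprod_mult. apply pprod_ext. intros n.
  replace (2 * (2 * (2 * n)) + 1)%nat with (8 * n + 1)%nat by lia.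
  replace (2 * (2 * (2 * n) + 1) + 1)%nat with (8 * n + 3)%nat by lia.
  replace (2 * (2 * (2 * n + 1)) + 1)%nat with (8 * n + 5)%nat by lia.
  replace (2 * (2 * (2 * n + 1) + 1) + 1)%nat with (8 * n + 7)%nat by lia. ring. }
rewrite <- E. field. lra.
Qed.

(** Factor by factor, because [p + p ^ 7 - p ^ 3 - p ^ 5 = p (1 - p ^ 2) (1 - p ^ 4)]. The
    comparison later gives [v < 1] and so decides between two roots. *)
Lemma theta17_div_eta_bounds (p : R) : 0 < p < 1 -> 0 <= theta17 p / eta (p ^ 8) <= theta35 p / eta
  (p ^ 8).
Proof.
intros Hp.
assert (P : forall k, 0 < p ^ (k + 1) < 1).
{ intros k. rewrite Nat.add_1_r. apply pow_unit, Hp. }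
assert (Q : forall k m, 0 < p ^ (k + S m) < 1).
{ intros k m. rewrite <- plus_n_Sm. apply pow_unit, Hp. }
assert (F : forall n, 0 < (1 - p ^ (8 * n + 1)) * (1 - p ^ (8 * n + 7))).
{ intros n. generalize (Q (8 * n)%nat 0%nat) (Q (8 * n)%nat 6%nat). intros.
  apply Rmult_lt_0_compat; lra. }
split.
- apply (is_lim_seq_le (fun _ => 0) (pprod (fun n => (1 - p ^ (8 * n + 1)) * (1 - p ^ (8 * n +
  7)))) 0 (theta17 p / eta (p ^ 8))).
  + intros N. apply Rlt_le, pprod_pos, F.
  + apply is_lim_seq_const.
  + apply is_lim_theta17, Hp.
- apply (is_lim_seq_le (pprod (fun n => (1 - p ^ (8 * n + 1)) * (1 - p ^ (8 * n + 7))))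
    (pprod (fun n => (1 - p ^ (8 * n + 3)) * (1 - p ^ (8 * n + 5)))) (theta17 p / eta (p ^ 8))
      (theta35 p / eta (p ^ 8))).
  + intros N. apply pprod_le. intros n. split. apply F.
    rewrite !(pow_add p (8 * n)). set (a := p ^ (8 * n)).
    assert (Ha : 0 < a) by (apply pow_lt; lra).
    assert (0 <= a * p * ((1 - p ^ 2) * (1 - p ^ 4))).
    { apply Rmult_le_pos. nra. generalize (pow_unit p 1 Hp) (pow_unit p 3 Hp). intros.
      apply Rmult_le_pos; lra. }
    apply Rminus_le.
    replace ((1 - a * p ^ 1) * (1 - a * p ^ 7) - (1 - a * p ^ 3) * (1 - a * p ^ 5)) with (- (a * p
      * ((1 - p ^ 2) * (1 - p ^ 4)))) by ring. lra.
  + apply is_lim_theta17, Hp.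
  + apply is_lim_theta35, Hp.
Qed.

(** A limit of positive products is only nonnegative; strictness follows from the nonzero product
    with [theta35 p]. *)
Lemma theta17_bounds (p : R) : 0 < p < 1 -> 0 < theta17 p <= theta35 p.
Proof.
intros Hp. assert (E8 := eta_pow_pos p 7 Hp). assert (E2 := eta_pow_pos p 1 Hp).
assert (E1 := eta_pos p Hp).
destruct (theta17_div_eta_bounds p Hp) as [H1 H2].
assert (H3 := theta17_mul_theta35 p Hp).
assert (0 < eta (p ^ 8) ^ 2 * (eta p / eta (p ^ 2))).
{ apply Rmult_lt_0_compat. apply pow_lt; lra. apply Rdiv_lt_0_compat; lra. }
assert (A : forall t, t / eta (p ^ 8) * eta (p ^ 8) = t) by (intros; field; lra).
assert (0 <= theta17 p) by (rewrite <- A; apply Rmult_le_pos; lra).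
split.
- destruct H0; trivial. rewrite <- H0 in H3. lra.
- rewrite <- (A (theta17 p)), <- (A (theta35 p)). apply Rmult_le_compat_r; lra.
Qed.

(** The norm form at [w = - 1 / p]: there [w p ^ 4 = - p ^ 3], and the factors become
    [1 + p ^ (4 n + 1)] and [1 + p ^ (4 n + 3)], which run over all odd exponents. *)
Lemma theta35_sqr_add_theta17_sqr (p : R) : 0 < p < 1 ->
  theta35 p ^ 2 + p * theta17 p ^ 2 = eta (p ^ 2) ^ 4 / (eta p * eta (p ^ 4)).
Proof.
intros Hp. assert (E4 := eta_pow_pos p 3 Hp). assert (E2 := eta_pow_pos p 1 Hp).
assert (E1 := eta_pos p Hp).
assert (Hi : 0 < / p) by (apply Rinv_0_lt_compat; lra).
assert (L := jacobi_triple_product_norm p (- / p) Hp ltac:(lra)).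
assert (M := is_lim_seq_double _ _ (is_lim_one_plus_odd p Hp)).
assert (E : (theta (- / p) (p ^ 4) ^ 2 - (- / p) * p ^ 2 * theta ((- / p) * p ^ 4) (p ^ 4) ^ 2) /
  eta (p ^ 2) ^ 2
  = eta (p ^ 2) ^ 2 / (eta p * eta (p ^ 4))).
{ apply Rbar_finite_eq. rewrite <- (is_lim_seq_unique _ _ L), <- (is_lim_seq_unique _ _ M).
  apply Lim_seq_ext. intros N. rewrite pprod_even_odd, <- pprod_mult. apply pprod_ext. intros n.
  replace (2 * (2 * n) + 1)%nat with (4 * n + 1)%nat by lia.
  replace (2 * (2 * n + 1) + 1)%nat with (S (S (4 * n + 1))) by lia.
  replace (4 * n + 2)%nat with (S (4 * n + 1)) by lia. simpl pow. field. lra. }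
replace (- / p * p ^ 4) with (- p ^ 3) in E by (field; lra).
fold (theta17 p) (theta35 p) in E.
replace (theta35 p ^ 2 + p * theta17 p ^ 2) with
  ((theta35 p ^ 2 - - / p * p ^ 2 * theta17 p ^ 2) / eta (p ^ 2) ^ 2 * eta (p ^ 2) ^ 2) by (field;
    lra).
rewrite E. field. lra.
Qed.

(* [v = sqrt p * theta17 p / theta35 p] is the root smaller than 1 of
   [v + 1 / v = 2 * sqrt (1 + k) / sqrt k]. *)
Lemma goellnitz_gordon_sqr (p k : R) : 0 < p < 1 -> k = theta_modulus (p ^ 2) ->
  p * (theta17 p / theta35 p) ^ 2 = (2 + k - 2 * sqrt (1 + k)) / k.
Proof.
intros Hp Hk. assert (Hy := sqr_unit p Hp).
assert (Bk := theta_modulus_bounds _ Hy). rewrite <- Hk in Bk.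
destruct (theta17_bounds p Hp) as [B1 B2].
assert (Hs := sqrt_unit p Hp). set (t := sqrt p) in *.
assert (St : t ^ 2 = p) by (apply pow2_sqrt; lra).
assert (Hsk := sqrt_unit k Bk). set (m := sqrt k) in *.
assert (Sm : m ^ 2 = k) by (apply pow2_sqrt; lra).
set (s := sqrt (1 + k)).
assert (Ss : s ^ 2 = 1 + k) by (apply pow2_sqrt; lra).
assert (Ps : 0 < s) by (apply sqrt_lt_R0; lra).
set (v := t * (theta17 p / theta35 p)).
assert (Hv : 0 < v < 1).
{ assert (0 < theta17 p / theta35 p <= 1).
  { split. apply Rdiv_lt_0_compat; lra. apply Rle_div_l; lra. }
  unfold v. split. apply Rmult_lt_0_compat; lra. nra. }
assert (E4 := eta_pow_pos p 3 Hp). assert (E2 := eta_pow_pos p 1 Hp). assert (E1 := eta_pos p Hp).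
assert (E8 := eta_pow_pos p 7 Hp).
assert (F1 := phi_pos p Hp). assert (F2 := phi_pos _ Hy). assert (F4 := psi_pos _ (pow4_unit p Hp)).
assert (Es : s = phi p / phi (p ^ 2)).
{ unfold s. rewrite Hk, one_plus_theta_modulus by trivial.
  replace (phi p ^ 2 / phi (p ^ 2) ^ 2) with ((phi p / phi (p ^ 2)) ^ 2) by (field; lra).
  apply sqrt_pow2. apply Rlt_le, Rdiv_lt_0_compat; trivial. }
assert (Em : m = 2 * t * psi (p ^ 4) / phi (p ^ 2)).
{ unfold m. rewrite Hk, theta_modulus_sqr by trivial.
  replace (4 * p * psi (p ^ 4) ^ 2 / phi (p ^ 2) ^ 2) with ((2 * t * psi (p ^ 4) / phi (p ^ 2)) ^
    2).
  - apply sqrt_pow2. apply Rlt_le, Rdiv_lt_0_compat; trivial. apply Rmult_lt_0_compat; lra.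
  - transitivity (4 * t ^ 2 * psi (p ^ 4) ^ 2 / phi (p ^ 2) ^ 2). field. lra. rewrite St. trivial. }
(* [v + 1 / v] is the sum of squares [theta35 p ^ 2 + p * theta17 p ^ 2] divided by
   [sqrt p * theta17 p * theta35 p], a ratio of known eta quotients. *)
assert (V : m * (v ^ 2 + 1) = 2 * s * v).
{ assert (X : theta17 p * theta35 p * (v ^ 2 + 1) = (theta35 p ^ 2 + p * theta17 p ^ 2) * (theta17
  p / theta35 p)).
  { transitivity ((theta35 p ^ 2 + t ^ 2 * theta17 p ^ 2) * (theta17 p / theta35 p)).
    unfold v. field. lra. rewrite St. trivial. }
  rewrite theta17_mul_theta35, theta35_sqr_add_theta17_sqr in X by trivial.
  rewrite Em, Es, psi_pow. unfold phi at 2. change (4 * 2)%nat with 8%nat.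
  set (a := theta17 p / theta35 p) in *. unfold v in *.
  set (b := (t * a) ^ 2 + 1) in *.
  assert (X' : b = eta (p ^ 2) ^ 5 / (eta p ^ 2 * eta (p ^ 4) * eta (p ^ 8) ^ 2) * a).
  { replace b with (eta (p ^ 8) ^ 2 * (eta p / eta (p ^ 2)) * b / (eta (p ^ 8) ^ 2 * (eta p / eta
      (p ^ 2)))).
    rewrite X. field. lra. field. lra. }
  rewrite X'. field. lra. }
replace (p * (theta17 p / theta35 p) ^ 2) with (v ^ 2) by (unfold v; rewrite Rpow_mult_distr, St;
  trivial).
(* [v * m] is a root of [y ^ 2 - 2 s y + m ^ 2], whose roots are [s - 1] and [s + 1] because
   [s ^ 2 - m ^ 2 = 1]; [v * m < 1] excludes the larger one. *)
assert (W : v * m = s - 1).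
{ assert (Z : (v * m - (s - 1)) * (v * m - (s + 1)) = 0).
  { replace ((v * m - (s - 1)) * (v * m - (s + 1))) with (m * (m * (v ^ 2 + 1)) - 2 * s * v * m +
      (s ^ 2 - 1 - m ^ 2)) by ring.
    rewrite V, Ss, Sm. ring. }
  apply Rmult_integral in Z. destruct Z as [Z|Z]. lra.
  assert (v * m < 1) by nra. lra. }
replace (2 + k - 2 * s) with ((v * m) ^ 2).
rewrite Rpow_mult_distr, Sm. field. lra.
rewrite W. replace ((s - 1) ^ 2) with (s ^ 2 - 2 * s + 1) by ring. rewrite Ss. ring.
Qed.

(** [k], [1 + k] and [1 - k] are theta quotients over the same [phi (p ^ 2) ^ 2]; the factor [4 p]
    cancels the one contained in [k]. *)
Lemma eta_quotient_modulus (p k : R) : 0 < p < 1 -> k = theta_modulus (p ^ 2) ->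
  (eta p / eta (p ^ 2)) ^ 24 = 4 * p * (1 - k) ^ 4 / (k * (1 + k) ^ 2).
Proof.
intros Hp ->. assert (Hy := sqr_unit p Hp).
rewrite one_plus_theta_modulus, one_minus_theta_modulus, theta_modulus_sqr by trivial.
assert (E4 := eta_pow_pos p 3 Hp). assert (E2 := eta_pow_pos p 1 Hp). assert (E1 := eta_pos p Hp).
assert (E8 := eta_pow_pos p 7 Hp).
assert (F1 := phi_pos p Hp). assert (F2 := phi_pos _ Hy). assert (F4 := psi_pos _ (pow4_unit p Hp)).
transitivity (phi_neg p ^ 8 / (phi (p ^ 2) ^ 2 * psi (p ^ 4) ^ 2 * phi p ^ 4)).
- rewrite phi_pow, psi_pow. unfold phi, phi_neg. cbn [Nat.mul Nat.add]. field. lra.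
- field. lra.
Qed.

(** Twelve powers of [p] from the continued fraction against one from the eta quotient give
    [p ^ 11]; in the same way [k ^ 13] is [k * k ^ 12]. *)
Lemma theta17_pow_48 (p k : R) : 0 < p < 1 -> k = theta_modulus (p ^ 2) ->
  p ^ 11 * (theta17 p / eta (p ^ 8)) ^ 48 =
  4 * (1 - k) ^ 4 * (2 + k - 2 * sqrt (1 + k)) ^ 12 / (k ^ 13 * (1 + k) ^ 2).
Proof.
intros Hp Hk. assert (Hy := sqr_unit p Hp).
assert (Bk := theta_modulus_bounds _ Hy). rewrite <- Hk in Bk.
assert (B := theta17_bounds p Hp). assert (E8 := eta_pow_pos p 7 Hp).
assert (G := goellnitz_gordon_sqr p k Hp Hk). assert (Q := eta_quotient_modulus p k Hp Hk).
transitivity ((eta p / eta (p ^ 2)) ^ 24 * (p * (theta17 p / theta35 p) ^ 2) ^ 12 / p).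
- replace (eta p / eta (p ^ 2)) with (theta17 p * theta35 p / eta (p ^ 8) ^ 2).
  field. lra. rewrite theta17_mul_theta35 by trivial. field. generalize (eta_pow_pos p 1 Hp). lra.
- rewrite G, Q. field. lra.
Qed.

Theorem theorem2 (r q k : R) (hr : 0 < r)
  (hq : q = exp (- PI * sqrt r)) (hk : k = singular_modulus r) :
  is_bilateral_series
    (fun n : Z => powerRZ (-1) n * Rpower q (2 * IZR n ^ 2 + 3 * IZR n / 2))
    (Rpower q (- 11 / 96) * eta (q ^ 4) *
     Rpower (4 * (1 - k) ^ 4 * (2 + k - 2 * sqrt (1 + k)) ^ 12 /
             (k ^ 13 * (1 + k) ^ 2)) (1 / 48)).
Proof.
assert (Hs := sqrt_lt_R0 r hr). generalize PI_RGT_0; intros HP.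
assert (Hq : 0 < q < 1).
{ rewrite hq. split. apply exp_pos. rewrite <- exp_0. apply exp_increasing. nra. }
assert (Hp := sqrt_unit q Hq). set (p := sqrt q) in *.
assert (Sp : p ^ 2 = q) by (apply pow2_sqrt; lra).
assert (Hk : k = theta_modulus (p ^ 2)) by (rewrite Sp, hk, hq; apply singular_modulus_theta, hr).
rewrite <- theta17_pow_48 with (p := p) by trivial.
assert (E8 := eta_pow_pos p 7 Hp). destruct (theta17_bounds p Hp) as [B _].
set (A := theta17 p / eta (p ^ 8)).
assert (HA : 0 < A) by (apply Rdiv_lt_0_compat; trivial).
assert (lq : ln q = 2 * ln p).
{ rewrite <- Sp, ln_pow by lra. simpl. ring. }
(* The prefactor is [p ^ (- 11 / 48)] and cancels the 48th root of [p ^ 11]. *)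
replace (Rpower q (- 11 / 96) * eta (q ^ 4) * Rpower (p ^ 11 * A ^ 48) (1 / 48)) with (theta17 p).
2: { replace (Rpower (p ^ 11 * A ^ 48) (1 / 48)) with (exp (11 / 48 * ln p) * A).
  - unfold Rpower. rewrite lq, <- Sp, <- pow_mult. change (2 * 4)%nat with 8%nat.
    transitivity (exp (- 11 / 96 * (2 * ln p) + 11 / 48 * ln p) * (eta (p ^ 8) * A)).
    + replace (- 11 / 96 * (2 * ln p) + 11 / 48 * ln p) with 0 by field. rewrite exp_0. unfold A.
      field. lra.
    + rewrite exp_plus. ring.
  - rewrite <- (exp_ln A) at 1 by trivial. rewrite <- exp_plus. unfold Rpower. f_equal.
    rewrite ln_mult, !ln_pow by (try apply pow_lt; lra).
    replace (INR 11) with 11 by (simpl; ring). replace (INR 48) with 48 by (simpl; ring). field. }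
(* Both terms have sign [(-1) ^ n] and absolute value [p ^ (4 n ^ 2 + 3 n)]. *)
assert (T : forall n : Z, powerRZ (- p ^ 3) n * powerRZ (p ^ 4) (n * n)
  = powerRZ (-1) n * Rpower q (2 * IZR n ^ 2 + 3 * IZR n / 2)).
{ intros n. replace (- p ^ 3) with (-1 * p ^ 3) by ring. rewrite powerRZ_mult, Rmult_assoc. f_equal.
  rewrite !powerRZ_Rpower by (apply pow_lt; lra). unfold Rpower. rewrite <- exp_plus. f_equal.
  rewrite !ln_pow, lq, mult_IZR by lra. simpl INR. field. }
unfold theta17, theta. rewrite (bsum_ext _ _ T).
apply bsummable_is_bilateral_series. eapply bsummable_ext. apply T.
apply bsummable_theta. apply pow4_unit, Hp. generalize (pow_unit p 2 Hp). lra.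
Qed.
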